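(* Let $1\le k\le n$ and let $\lambda=(\mu,\nu)$ be an $(n,k)$-bipartition. Then $R_\lambda^{(k)}$ is isomorphic, as an $S_n$-module, to the Solomon descent representation $\rho^{A_\lambda}$ determined by the descent class $\{\pi\in S_n:\mathrm{Des}(\pi)=A_\lambda\}$.
   Context: Let $\mathbf{Q}[\bar x,\bar y]=\mathbf{Q}[x_1,\dots,x_n,y_1,\dots,y_n]$ with $S_n$ acting by $\sigma(x_i)=x_{\sigma(i)}$, $\sigma(y_i)=y_{\sigma(i)}$. For the hook shape $\mu=(1^{k-1},n-k+1)$ let $\Delta_\mu$ be the determinant of the $n\times n$ matrix whose $i$-th row is $(1,y_i,\dots,y_i^{n-k},x_i,\dots,x_i^{k-1})$. Let $\mathbf{H}_\mu$ be the $\mathbf{Q}$-span of all partial derivatives (of all orders, including order $0$) of $\Delta_\mu$. Let $\langle f,g\rangle$ be the constant term of $f(\partial_{x_1},\dots,\partial_{x_n};\partial_{y_1},\dots,\partial_{y_n})\,g(\bar x;\bar y)$, let $J_\mu=\mathbf{H}_\mu^\perp$ with respect to $\langle\ ,\ \rangle$ (an $S_n$-invariant ideal), and $\mathbf{H}'_\mu=\mathbf{Q}[\bar x,\bar y]/J_\mu$. For $\pi\in S_n$ let $\mathrm{Des}(\pi)=\{1\le i\le n-1:\pi(i)>\pi(i+1)\}$; let $d_i=|\mathrm{Des}(\pi)\cap\{i,\dots,k-1\}|$ for $1\le i<k$, $d_k=0$, $d_i=|\mathrm{Des}(\pi)\cap\{k,\dots,i-1\}|$ for $k<i\le n$, and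 $a_\pi^{(k)}=\prod_{i=1}^{k-1}x_{\pi(i)}^{d_i}\prod_{i=k+1}^{n}y_{\pi(i)}^{d_i}$. Its exponent bipartition is $\lambda(a_\pi^{(k)})=((d_1,\dots,d_{k-1},0),(d_n,d_{n-1},\dots,d_{k+1},0))$. An $(n,k)$-bipartition is a pair $\lambda=(\mu,\nu)$ of partitions $\mu=(\mu_1\ge\cdots\ge\mu_{k-1}\ge\mu_k=0)$, $\nu=(\nu_1\ge\cdots\ge\nu_{n-k}\ge\nu_{n-k+1}=0)$ with $\mu_i-\mu_{i+1}\in\{0,1\}$ for $1\le i\le k-1$ and $\nu_i-\nu_{i+1}\in\{0,1\}$ for $1\le i\le n-k$. Put $A_\lambda=\{1\le i<k:\mu_i-\mu_{i+1}=1\}\cup\{k\le i<n:\nu_{n-i}-\nu_{n-i+1}=1\}$. For bipartitions, $(\mu^1,\nu^1)\trianglelefteq(\mu^2,\nu^2)$ means $\mu^1\trianglelefteq\mu^2$ and $\nu^1\trianglelefteq\nu^2$ in dominance order of partitions (of equal size); $\triangleleft$ means $\trianglelefteq$ and not equal. Put $I_\lambda^{(k)\trianglelefteq}=\mathrm{span}_{\mathbf{Q}}\{a_\pi^{(k)}+J_{(1^{k-1},n-k+1)}:\lambda(a_\pi^{(k)})\trianglelefteq\lambda\}$, $I_\lambda^{(k)\triangleleft}=\mathrm{span}_{\mathbf{Q}}\{a_\pi^{(k)}+J_{(1^{k-1},n-k+1)}:\lambda(a_\pi^{(k)})\triangleleft\lambda\}$ (both are $S_n$-invariant subspaces of $\mathbf{H}'_{(1^{k-1},n-k+1)}$)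 and $R_\lambda^{(k)}=I_\lambda^{(k)\trianglelefteq}/I_\lambda^{(k)\triangleleft}$. Solomon descent representation: for $A\subseteq\{1,\dots,n-1\}$, $\rho^A$ is the $S_n$-representation whose character is $\sum_{B\subseteq A}(-1)^{|A\setminus B|}\,\mathrm{Ind}_{S_{c(B)}}^{S_n}1$, where for $B=\{b_1<\dots<b_r\}$, $S_{c(B)}$ is the Young subgroup $S_{b_1}\times S_{b_2-b_1}\times\cdots\times S_{n-b_r}$. Equivalently, the multiplicity in $\rho^A$ of the irreducible representation indexed by a partition $\alpha\vdash n$ is the number of standard Young tableaux $T$ of shape $\alpha$ with $\mathrm{Des}(T)=A$, where $i\in\mathrm{Des}(T)$ iff $i+1$ lies strictly above and weakly to the left of $i$ in $T$ (French notation). *)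

(* Defs.v *)
From HB Require Import structures.
From mathcomp Require Import all_boot all_order all_algebra all_fingroup.
From mathcomp Require Import all_field all_character.
From mathcomp Require Import generic_quotient ring_quotient boolp.
From mathcomp Require Import ssrcomplements mpoly.

Set Implicit Arguments.
Unset Strict Implicit.
Unset Printing Implicit Defensive.

Import GRing.Theory Quotient.
Local Open Scope ring_scope.
Local Open Scope quotient_scope.

Section QuotientModule.
Variables (K : nzRingType) (V : lmodType K) (W : submodClosed V).

(* MathComp's [submodClosed] does not provide the closure under opposite that
   [Quotient.quot] needs, although it is automatic over a ring. *)
Definition submod_pred : {pred V} := W.

Fact submod_pred_closed : zmod_closed submod_pred.
Proof.
have [W0 WZD] := submodClosedP W; split=> // u v uW vW.
by rewrite -scaleN1r addrC WZD.
Qed.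
HB.instance Definition _ :=
  GRing.isZmodClosed.Build V submod_pred submod_pred_closed.

Definition lquot := quot submod_pred.
HB.instance Definition _ := EqQuotient.on lquot.
HB.instance Definition _ := GRing.Zmodule.on lquot.
Local Notation Q := lquot.

Lemma eq_lquot u v : (\pi_Q u == \pi_Q v) = (u - v \in W).
Proof. by rewrite -(idealrBE submod_pred). Qed.

Lemma pi_lquot_is_zmod_morphism : zmod_morphism \pi_Q.
Proof. exact: (@pi_is_zmod_morphism _ _ _ (quot submod_pred)). Qed.
HB.instance Definition _ :=
  GRing.isZmodMorphism.Build V Q \pi_Q pi_lquot_is_zmod_morphism.

Definition quot_scale (a : K) (x : Q) : Q := \pi_Q (a *: repr x).

Lemma pi_quot_scale a v : \pi_Q (a *: v) = quot_scale a (\pi_Q v).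
Proof.
apply/eqP; rewrite eq_lquot -scalerBr; apply: rpredZ.
by rewrite -eq_lquot reprK.
Qed.

Fact quot_scaleA a b v : quot_scale a (quot_scale b v) = quot_scale (a * b) v.
Proof.
by rewrite -[v]reprK -(pi_quot_scale b (repr v)) -!pi_quot_scale scalerA.
Qed.
Fact quot_scale1 : left_id 1 quot_scale.
Proof. by move=> v; rewrite -[v]reprK -!pi_quot_scale scale1r. Qed.
Fact quot_scaleDr : right_distributive quot_scale +%R.
Proof.
move=> a u v; rewrite -[u]reprK -[v]reprK -raddfD -!pi_quot_scale.
by rewrite scalerDr raddfD.
Qed.
Fact quot_scaleDl v : {morph quot_scale^~ v : a b / a + b}.
Proof. by move=> a b; rewrite -[v]reprK -!pi_quot_scale scalerDl raddfD. Qed.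

HB.instance Definition _ :=
  GRing.Zmodule_isLmodule.Build K Q
    quot_scaleA quot_scale1 quot_scaleDr quot_scaleDl.

Fact pi_quot_is_scalable : scalable \pi_Q.
Proof. exact: pi_quot_scale. Qed.
HB.instance Definition _ :=
  GRing.isScalable.Build K V Q *:%R \pi_Q pi_quot_is_scalable.

(* Meaningful when [f] is linear and stabilises [W], see [quot_mapE]. *)
Definition quot_map (f : V -> V) (x : Q) : Q := \pi_Q (f (repr x)).

Lemma quot_mapE (f : {linear V -> V}) v :
  (forall w, w \in W -> f w \in W) -> quot_map f (\pi_Q v) = \pi_Q (f v).
Proof.
move=> fW; apply/eqP; rewrite eq_lquot -linearB; apply: fW.
by rewrite -eq_lquot reprK.
Qed.

End QuotientModule.

Section SubModule.
Variables (K : nzRingType) (V : lmodType K).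

Definition submod (U : submodClosed V) := {v : V | v \in U}.

Section Instances.
Variable U : submodClosed V.
HB.instance Definition _ := SubChoice.on (submod U).
HB.instance Definition _ := [SubChoice_isSubLmodule of submod U by <:].
End Instances.

Definition submod_map (U : submodClosed V) (f : V -> V)
    (fU : forall v, v \in U -> f v \in U) (u : submod U) : submod U :=
  Sub (f (val u)) (fU _ (valP u)).

Fact submod_map_is_linear U (f : {linear V -> V}) fU :
  linear (@submod_map U f fU).
Proof. by move=> a u v; apply: val_inj; rewrite /= linearP. Qed.
HB.instance Definition _ U (f : {linear V -> V}) fU :=
  GRing.isLinear.Build K (submod U) (submod U) *:%R (@submod_map U f fU)
    (@submod_map_is_linear U f fU).

Definition submod_trace (U W : submodClosed V) : {pred submod U} :=
  fun u => val u \in W.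

Fact submod_trace_closed U W : submod_closed (@submod_trace U W).
Proof.
have [W0 WZD] := submodClosedP W; split=> [|a u v]; first exact: W0.
exact: (WZD a (val u) (val v)).
Qed.
HB.instance Definition _ U W :=
  GRing.isSubmodClosed.Build K (submod U) (@submod_trace U W)
    (submod_trace_closed U W).

Definition subquot (U W : submodClosed V) := lquot (@submod_trace U W).

Definition lspan (S : V -> Prop) : {pred V} := fun v =>
  `[< exists (m : nat) (c : 'I_m -> K) (w : 'I_m -> V),
        (forall i, S (w i)) /\ v = \sum_i c i *: w i >].

Lemma lspanP S v :
  reflect (exists (m : nat) (c : 'I_m -> K) (w : 'I_m -> V),
             (forall i, S (w i)) /\ v = \sum_i c i *: w i)
          (v \in lspan S).
Proof. exact: asboolP. Qed.

Fact lspan_closed S : submod_closed (lspan S).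
Proof.
split=> [|a _ _ /lspanP[m [c [u [Su ->]]]] /lspanP[p [d [w [Sw ->]]]]].
  apply/lspanP; exists 0, (fun=> 0), (fun=> 0); split; first by case.
  by rewrite big_ord0.
apply/lspanP; exists (m + p)%N.
exists (fun i => match split i with inl j => a * c j | inr j => d j end).
exists (fun i => match split i with inl j => u j | inr j => w j end).
split=> [i|]; first by case: split.
rewrite big_split_ord scaler_sumr; congr (_ + _); apply: eq_bigr => i _.
  by rewrite (unsplitK (inl i)) scalerA.
by rewrite (unsplitK (inr i)).
Qed.
HB.instance Definition _ S :=
  GRing.isSubmodClosed.Build K V (lspan S) (lspan_closed S).

Lemma lspan_gen (S : V -> Prop) v : S v -> v \in lspan S.
Proof.
move=> Sv; apply/lspanP; exists 1%N, (fun=> 1), (fun=> v); split=> //.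
by rewrite big_ord1 scale1r.
Qed.

Lemma lspan_ind (S : V -> Prop) (U : submodClosed V) :
  (forall v, S v -> v \in U) -> forall v, v \in lspan S -> v \in U.
Proof.
move=> SU _ /lspanP[m [c [w [Sw ->]]]].
by apply: rpred_sum => i _; rewrite rpredZ ?SU.
Qed.

End SubModule.

(* The variables x_1, ..., x_n, y_1, ..., y_n are indexed by 'I_(n + n), and a
   permutation of {1, ..., n} is seen as acting on 'I_n = {0, ..., n - 1}. *)
Section GarsiaHaiman.
Variables n k : nat.
Local Notation P := {mpoly rat[n + n]}.

Definition xvar (i : 'I_n) : P := 'X_(lshift n i).
Definition yvar (i : 'I_n) : P := 'X_(rshift n i).

Definition diag_fun (s : 'S_n) (i : 'I_(n + n)) : 'I_(n + n) :=
  match split i with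
  | inl j => lshift n (s j)
  | inr j => rshift n (s j)
  end.

Fact diag_fun_inj s : injective (diag_fun s).
Proof.
apply: (can_inj (g := diag_fun s^-1%g)) => i; rewrite /diag_fun.
rewrite -{2}[i]splitK; case: (split i) => j.
  by rewrite (unsplitK (inl (s j))) permK.
by rewrite (unsplitK (inr (s j))) permK.
Qed.

Definition diag_perm (s : 'S_n) : 'S_(n + n) := perm (@diag_fun_inj s).

(* MathComp composes permutations from left to right, so this is a right
   action: it matches matrix representations acting on row vectors. *)
Definition poly_act (s : 'S_n) : P -> P := msym (diag_perm s).
HB.instance Definition _ s := GRing.Linear.on (poly_act s).
HB.instance Definition _ s := GRing.RMorphism.on (poly_act s).

Lemma poly_act_xvar s i : poly_act s (xvar i) = xvar (s i).
Proof.
rewrite /poly_act /msym mmapX mmap1U permE /diag_fun.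
by rewrite (unsplitK (inl i)).
Qed.

Lemma poly_act_yvar s i : poly_act s (yvar i) = yvar (s i).
Proof.
rewrite /poly_act /msym mmapX mmap1U permE /diag_fun.
by rewrite (unsplitK (inr i)).
Qed.

Definition Delta_mx : 'M[P]_n :=
  \matrix_(i, j) if (j <= n - k)%N then yvar i ^+ j
                 else xvar i ^+ (j - (n - k)).
Definition Delta : P := \det Delta_mx.

Definition Hspace : {pred P} :=
  lspan (fun h => exists m : 'X_{1..n + n}, h = Delta^`M[m]).
HB.instance Definition _ := GRing.SubmodClosed.on Hspace.

Definition pairing (f g : P) : rat :=
  (\sum_(m <- msupp f) f@_m *: g^`M[m])@_0%MM.

Definition Jideal : {pred P} :=
  fun f => `[< forall h, h \in Hspace -> pairing f h = 0 >].

Lemma JidealP f :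
  reflect (forall h, h \in Hspace -> pairing f h = 0) (f \in Jideal).
Proof. exact: asboolP. Qed.

Definition mfact (m : 'X_{1..n + n}) : nat := (\prod_i (m i)`!)%N.

Lemma pairingE f g :
  pairing f g = \sum_(m <- msupp f) f@_m * (g@_m *+ mfact m).
Proof.
rewrite /pairing raddf_sum; apply: eq_bigr => m _ /=.
rewrite mcoeffZ mcoeff_mderivm addm0; congr (_ * (_ *+ _)).
by apply: eq_bigr => i _; rewrite ffactnn.
Qed.

Lemma pairing_widen f g d : (msize f <= d)%N ->
  pairing f g = \sum_(m : 'X_{1..(n + n) < d}) f@_m * (g@_m *+ mfact m).
Proof.
move=> le_fd; pose p (m : 'X_{1..(n + n) < d}) := val m \in msupp f.
rewrite [RHS](bigID p) {}/p /= addrC big1 ?add0r; last first.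
  by move=> m /memN_msupp_eq0 ->; rewrite mul0r.
rewrite pairingE (big_mksub 'X_{1..(n + n) < d}) //=; first exact: msupp_uniq.
by move=> m /msize_mdeg_lt /leq_trans; apply.
Qed.

Lemma pairing_linearl h : linear (fun f => pairing f h : rat^o).
Proof.
move=> a f g; pose d := maxn (msize (a *: f + g)) (maxn (msize f) (msize g)).
rewrite !(@pairing_widen _ _ d) ?leq_max ?leqnn ?orbT //.
rewrite scaler_sumr -big_split; apply: eq_bigr => m _ /=.
by rewrite mcoeffD mcoeffZ mulrDl -mulrA.
Qed.

Fact Jideal_closed : submod_closed Jideal.
Proof.
split=> [|a f g /JidealP fJ /JidealP gJ]; apply/JidealP => h hH.
  by rewrite pairingE msupp0 big_nil.
by rewrite (pairing_linearl h) fJ // gJ // addr0 scaler0.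
Qed.
HB.instance Definition _ :=
  GRing.isSubmodClosed.Build rat P Jideal Jideal_closed.

Local Notation "m # t" := [multinom m (fun_of_perm t i) | i < n + n]
  (at level 40, left associativity).

Lemma mfact_perm (m : 'X_{1..n + n}) (t : 'S_(n + n)) :
  mfact (m # t) = mfact m.
Proof.
rewrite /mfact [RHS](reindex_inj (@perm_inj _ t)) /=.
by apply: eq_bigr => i _; rewrite mnmE.
Qed.

Lemma pairing_msym (t : 'S_(n + n)) f g :
  pairing (msym t f) (msym t g) = pairing f g.
Proof.
pose inv (m : 'X_{1..n + n}) : 'X_{1..n + n} := m # (t^-1)%g.
pose dir (m : 'X_{1..n + n}) : 'X_{1..n + n} := m # t.
have actK : cancel inv dir.
  by move=> m; apply/mnmP => i; rewrite !mnmE permK.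
have Kact : cancel dir inv.
  by move=> m; apply/mnmP => i; rewrite !mnmE permKV.
have supp_t : perm_eq (msupp (msym t f)) [seq inv m | m <- msupp f].
  apply: uniq_perm; first exact: msupp_uniq.
    by rewrite map_inj_uniq //; apply: can_inj actK.
  move=> m; rewrite -[m in RHS]Kact mem_map; last exact: can_inj actK.
  by rewrite !mcoeff_msupp mcoeff_sym.
rewrite !pairingE (perm_big _ supp_t) big_map; apply: eq_bigr => m _.
by rewrite !mcoeff_sym -!/(dir _) actK mfact_perm.
Qed.

Lemma msym_mderivm (t : 'S_(n + n)) (p : P) m :
  msym t p^`M[m] = (msym t p)^`M[(m # (t^-1)%g)].
Proof.
apply/mpolyP => m'; rewrite mcoeff_sym !mcoeff_mderivm mcoeff_sym.
congr (p@_ _ *+ _).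
  by apply/mnmP => i; rewrite !mnmE permK.
rewrite [RHS](reindex_inj (@perm_inj _ t)) /=.
by apply: eq_bigr => i _; rewrite !mnmE permK.
Qed.

Lemma poly_act_Delta s : poly_act s Delta = (-1) ^+ s *: Delta.
Proof.
rewrite /Delta -det_map_mx.
have -> : map_mx (poly_act s) Delta_mx = row_perm s Delta_mx.
  apply/matrixP => i j; rewrite !mxE; case: ifP => _.
    by rewrite rmorphXn /= poly_act_yvar.
  by rewrite rmorphXn /= poly_act_xvar.
rewrite row_permE det_mulmx det_perm -mul_mpolyC.
by rewrite rmorphXn rmorphN rmorph1.
Qed.

Lemma poly_act_H s h : h \in Hspace -> poly_act s h \in Hspace.
Proof.
case/lspanP=> d [c [w [Hw ->]]]; rewrite linear_sum.
apply: rpred_sum => i _; rewrite linearZ rpredZ //=.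
have [m ->] := Hw i; rewrite /poly_act msym_mderivm.
rewrite -[msym _ _]/(poly_act s Delta) poly_act_Delta mderivmZ rpredZ //.
by apply: lspan_gen; eexists.
Qed.

Lemma poly_act_J s f : f \in Jideal -> poly_act s f \in Jideal.
Proof.
move=> /JidealP fJ; apply/JidealP => h hH.
have sK : poly_act s (poly_act s^-1%g h) = h.
  apply/mpolyP => m; rewrite !mcoeff_sym; congr (h@_ _).
  apply/mnmP => i; rewrite !mnmE; congr (m _).
  rewrite !permE /diag_fun -{2}[i]splitK; case: (split i) => j.
    by rewrite (unsplitK (inl (s^-1%g j))) permKV.
  by rewrite (unsplitK (inr (s^-1%g j))) permKV.
by rewrite -sK pairing_msym fJ // poly_act_H.
Qed.

Definition Hquot := lquot Jideal.

Definition Hquot_act (s : 'S_n) : Hquot -> Hquot := quot_map (poly_act s).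

Lemma Hquot_actE s p : Hquot_act s (\pi_Hquot p) = \pi_Hquot (poly_act s p).
Proof. exact: quot_mapE (poly_act_J s). Qed.

Fact Hquot_act_is_linear s : linear (Hquot_act s).
Proof.
move=> a u v; rewrite -[u]reprK -[v]reprK -linearP !Hquot_actE.
by rewrite !linearP.
Qed.
HB.instance Definition _ s :=
  GRing.isLinear.Build rat Hquot Hquot *:%R (Hquot_act s)
    (Hquot_act_is_linear s).

(* A subset of {1, ..., n - 1} is a {set 'I_n} avoiding the ordinal 0: the
   ordinal i stands for the number i, and the 1-based positions i and i + 1
   are the ordinals j and i below. *)
Definition Des (s : 'S_n) : {set 'I_n} :=
  [set i : 'I_n | [exists j : 'I_n, (j.+1 == i) && (s i < s j)%N]].

(* Here [i] is a 1-based position. *)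
Definition dexp (s : 'S_n) (i : nat) : nat :=
  if (i < k)%N then #|[set j in Des s | (i <= j < k)%N]|
  else #|[set j in Des s | (k <= j < i)%N]|.

Definition a_mon (s : 'S_n) : P :=
  (\prod_(i < n | (i.+1 < k)%N) xvar (s i) ^+ dexp s i.+1)
  * (\prod_(i < n | (k < i.+1)%N) yvar (s i) ^+ dexp s i.+1).

Definition exp_bipart (s : 'S_n) : seq nat * seq nat :=
  (rcons [seq dexp s i | i <- iota 1 k.-1] 0%N,
   rcons (rev [seq dexp s i | i <- iota k.+1 (n - k)]) 0%N).

Definition step_partition (m : nat) (p : seq nat) : bool :=
  [&& size p == m, sorted geq p, nth 0%N p m.-1 == 0%N
    & all (fun i => (nth 0%N p i - nth 0%N p i.+1 <= 1)%N) (iota 0 m.-1)].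

Definition is_bipartition (lam : seq nat * seq nat) : bool :=
  step_partition k lam.1 && step_partition (n - k).+1 lam.2.

Definition A_of (lam : seq nat * seq nat) : {set 'I_n} :=
  [set i : 'I_n | (1 <= i < k)%N
     && (nth 0%N lam.1 i.-1 - nth 0%N lam.1 i == 1)%N]
  :|: [set i : 'I_n | (k <= i)%N
     && (nth 0%N lam.2 (n - i).-1 - nth 0%N lam.2 (n - i) == 1)%N].

End GarsiaHaiman.

Definition dominated (p q : seq nat) : Prop :=
  sumn p = sumn q /\ forall i, (sumn (take i p) <= sumn (take i q))%N.

Definition bidominated (l1 l2 : seq nat * seq nat) : Prop :=
  dominated l1.1 l2.1 /\ dominated l1.2 l2.2.

Section DescentModule.
Variables (n k : nat) (lam : seq nat * seq nat).

Definition I_le : {pred Hquot n k} :=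
  lspan (fun v => exists2 s : 'S_n,
    bidominated (exp_bipart k s) lam & v = \pi_(Hquot n k) (a_mon k s)).
HB.instance Definition _ := GRing.SubmodClosed.on I_le.

Definition I_lt : {pred Hquot n k} :=
  lspan (fun v => exists2 s : 'S_n,
    bidominated (exp_bipart k s) lam /\ exp_bipart k s <> lam
    & v = \pi_(Hquot n k) (a_mon k s)).
HB.instance Definition _ := GRing.SubmodClosed.on I_lt.

Definition Rmod := subquot I_le I_lt.

Definition Sn_stable (U : {pred Hquot n k}) : Prop :=
  forall (s : 'S_n) v, v \in U -> Hquot_act s v \in U.

(* The action induced on the quotient by that of [Hquot]; it is independent of
   representatives because [I_lt] is invariant as well, see [Rmod_actE]. *)
Definition Rmod_act (Ile : Sn_stable I_le) (s : 'S_n) : Rmod -> Rmod :=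
  quot_map (submod_map (Ile s)).

Lemma Rmod_actE (Ile : Sn_stable I_le) (Ilt : Sn_stable I_lt) s u :
  Rmod_act Ile s (\pi_Rmod u) = \pi_Rmod (submod_map (Ile s) u).
Proof. by apply: quot_mapE => w; apply: Ilt. Qed.

End DescentModule.

Arguments I_le : clear implicits.
Arguments I_lt : clear implicits.

Section Solomon.
Variable n : nat.

(* S_{b_1} x S_{b_2 - b_1} x ... x S_{n - b_r} for B = {b_1 < ... < b_r}: the
   ordinal [i] represents the letter i + 1, and i + 1 <= b iff i < b. *)
Definition young_set (B : {set 'I_n}) : {set 'S_n} :=
  [set s : 'S_n | [forall i : 'I_n, [forall b in B,
     (i < b)%N == (s i < b)%N]]].

Fact young_group_set B : group_set (young_set B).
Proof.
apply/group_setP; split=> [|s t].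
  by rewrite inE; apply/forallP=> i; apply/forall_inP=> b _; rewrite perm1.
rewrite !inE => /forallP sB /forallP tB.
apply/forallP => i; apply/forall_inP => b bB; rewrite permM.
have /forall_inP/(_ b bB)/eqP -> := sB i.
by have /forall_inP/(_ b bB) := tB (s i).
Qed.
Canonical young_group B : {group 'S_n} := Group (young_group_set B).

Definition solomon_char (A : {set 'I_n}) : 'CF([set: 'S_n]) :=
  \sum_(B : {set 'I_n} | B \subset A)
    (-1) ^+ #|A :\: B| *: 'Ind[[set: 'S_n], young_group B] 1.

Definition is_solomon_repr (A : {set 'I_n}) d
    (rho : mx_representation rat [set: 'S_n] d) : Prop :=
  cfRepr (map_repr (@ratr algC) rho) = solomon_char A.

End Solomon.

(* Main.v *)
Require Import Defs.
From mathcomp Require Import all_boot all_order all_algebra all_fingroup.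
From mathcomp Require Import all_field all_character.
From HB Require Import structures.
From mathcomp Require Import generic_quotient boolp mpoly zify.

(** A monomial in which no index carries both an [x] and a [y] is encoded by the
    integer function [e] on indices: [e i] is the exponent of [x_i] if positive,
    minus that of [y_i] if negative.  Up to a reordering of the indices, such a
    function is a weight: a weakly decreasing function of the position vanishing
    at position [k - 1].  In this language the descent monomial of [p] is the
    weight [wt (Des p)], with unit steps exactly at the descents, placed along
    [p]; Delta is the alternating sum of the staircase weight placed along all
    permutations; and bidominance is dominance of prefix sums.  Permutations
    compose from left to right, so the group acts on variables by right
    multiplication while Young subgroups permute positions on the left.

    Relations.  Pairing a monomial with a derivative of Delta reads off one
    coefficient of Delta.  Hence monomials dividing no monomial of Delta lie in
    [J], and so does any multiple of the symmetrisation of a nonconstant monomial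
    ([orbit_sum_Jideal]): the cells of a hook are closed under divisibility, so
    a term can survive only against a monomial with two equal exponents, where
    the alternation of Delta kills the sum.

    Straightening.  Let [d] be a weight, [Des s = B] a subset of its breaks, and
    write [d = wt B + e].  Expanding the descent monomial of [s] times the
    symmetrisation of the monomial of [e] shows that the sum of the monomials of
    weight [d] over the coset [W_B s] is, if [e] is not zero, a combination of
    monomials of strictly smaller weight ([young_sum_lower]).  Since [s] is the
    lexicographically least element of [W_B s], these coset sums span, by
    triangularity ([young_triangular]), everything invariant under the Young
    subgroup; induction on dominance turns every monomial into a combination of
    descent monomials of dominated weight ([straightening]).  So both spans of
    the statement are spans of monomials, and they are stable.

    Independence.  A descent monomial times the monomial of [staircase - wt A]
    placed along [p] can meet Delta only if its weight dominates [wt A]; for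
    equal weights, only if it comes from a permutation that is
    lexicographically at most [p] ([Delta_costair_lex]).  The pairing matrix is
    therefore triangular, and the descent monomials with descent set [A] form a
    basis of the quotient module.

    Character.  The indicators of the cosets [W_(Des p) p] form a basis of the
    regular representation, and those with [Des p] inside [A] span its
    [W_A]-invariants, a copy of the representation induced from [W_A].  By the
    coset-sum relation, the action on the quotient module is the diagonal block
    [Des p = A] of the regular representation in this basis
    ([act_descent_class]).  Traces thus add up to the induced characters
    ([descent_trace]), and Moebius inversion gives the Solomon character. *)

Set Implicit Arguments.
Unset Strict Implicit.
Unset Printing Implicit Defensive.

Import GRing.Theory Num.Theory Order.TTheory.
Local Open Scope ring_scope.
Local Open Scope quotient_scope.

(** * Permutations, descents and Young subgroups *)

Section LexOrder.
Variable n : nat.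
Implicit Types (s t u w : 'S_n) (A B : {set 'I_n}).

Definition lexlt s t : bool :=
  [exists p : 'I_n, (s p < t p)%N && [forall q : 'I_n, (q < p)%N ==> (s q == t q)]].

Lemma lexltP s t :
  reflect (exists2 p : 'I_n, (s p < t p)%N & forall q : 'I_n, (q < p)%N -> s q = t q)
          (lexlt s t).
Proof.
apply: (iffP existsP) => [[p /andP[lt_p /forallP eq_q]]|[p lt_p eq_q]]; exists p.
- exact: lt_p.
- by move=> q lt_qp; apply/eqP; move: (eq_q q); rewrite lt_qp.
by rewrite lt_p; apply/forallP=> q; apply/implyP=> /eq_q ->.
Qed.

Lemma lexlt_irr s : lexlt s s = false.
Proof. by apply/lexltP => -[p]; rewrite ltnn. Qed.

Lemma lexlt_trans : transitive lexlt.
Proof.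
move=> t s u /lexltP[p ltp eqp] /lexltP[q ltq eqq]; apply/lexltP.
case: (ltngtP p q) => [lt_pq|lt_qp|/val_inj eq_pq].
- by exists p => [|r lt_rp]; [rewrite -eqq | rewrite eqp // eqq // (ltn_trans lt_rp)].
- by exists q => [|r lt_rq]; [rewrite eqp | rewrite eqp ?eqq // (ltn_trans lt_rq)].
subst q; exists p => [|r lt_rp]; first exact: ltn_trans ltp ltq.
by rewrite eqp ?eqq.
Qed.

(** A numerical measure of the lexicographic order, for inductions along it. *)
Definition lexrank t := #|[set s | lexlt s t]|.

Lemma lexrank_lt s t : lexlt s t -> (lexrank s < lexrank t)%N.
Proof.
move=> lt_st; apply: proper_card; apply/properP; split.
  by apply/subsetP=> u; rewrite !inE => /lexlt_trans; apply.
by exists s; rewrite !inE ?lexlt_irr.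
Qed.

Lemma first_moved_point w : w != 1%g ->
  exists2 p : 'I_n, (p < w p)%N & forall q : 'I_n, (q < p)%N -> w q = q.
Proof.
move=> w1; have [p0 wp0] : exists p, w p != p.
  apply/existsP; apply: contraNT w1 => /existsPn w_id.
  by apply/eqP/permP=> p; rewrite perm1; apply/eqP; rewrite -[_ == _]negbK.
have [p wp min_p] := @arg_minnP _ p0 (fun p => w p != p) val wp0.
have fix_lt (q : 'I_n) : (q < p)%N -> w q = q.
  by move=> lt_qp; apply/eqP/contraT => /min_p /=; rewrite leqNgt lt_qp.
exists p => //; case: (ltngtP p (w p)) => // [lt_wp|/val_inj eq_wp].
  by move/fix_lt/perm_inj: (lt_wp) => eq_wp; rewrite eq_wp eqxx in wp.
by rewrite -eq_wp eqxx in wp.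
Qed.

(** Lets ascents, descents or equalities between neighbours propagate along an
    interval of positions. *)
Lemma ord_chain T (R : T -> T -> Prop) (f : 'I_n -> T) (p q : 'I_n) :
    (forall a b c, R a b -> R b c -> R a c) -> (p < q)%N ->
    (forall i j : 'I_n, j.+1 = i -> (p <= j)%N -> (i <= q)%N -> R (f j) (f i)) ->
  R (f p) (f q).
Proof.
move=> trR lt_pq; have [m def_q] : exists m, q = (p + m).+1 :> nat.
  by exists (q - p).-1; lia.
elim: m q def_q {lt_pq} => [|m IHm] q def_q Rstep; first by apply: Rstep; lia.
have lt_q' : ((p + m).+1 < n)%N by have := ltn_ord q; lia.
apply: trR (IHm (Ordinal lt_q') erefl _) (Rstep q (Ordinal lt_q') _ _ _) => /=; try lia.
by move=> i j def_i le_pj le_i; apply: Rstep; lia.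
Qed.

Lemma youngP B w :
  reflect (forall (p b : 'I_n), b \in B -> (p < b)%N = (w p < b)%N) (w \in young_set B).
Proof.
rewrite inE; apply: (iffP forallP) => [h p b bB | h p].
  by have /forall_inP/(_ b bB)/eqP := h p.
by apply/forall_inP=> b bB; rewrite (h p b bB).
Qed.

Lemma young_subset A B : B \subset A -> young_set A \subset young_set B.
Proof.
by move=> /subsetP sBA; apply/subsetP=> w /youngP wA; apply/youngP=> p b /sBA /wA.
Qed.

Lemma mem_Des s (i j : 'I_n) : j.+1 = i -> (i \in Des s) = (s i < s j)%N.
Proof.
move=> def_i; rewrite inE; apply/existsP/idP => [[j' /andP[/eqP def_i' lt_s]]|lt_s].
  by have -> : j = j' by apply: val_inj => /=; lia.
by exists j; rewrite def_i eqxx.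
Qed.

Lemma Des_gt0 s i : i \in Des s -> (0 < i)%N.
Proof. by rewrite inE => /existsP[j /andP[/eqP <-]]. Qed.

Lemma ascent_in_block B s (p q : 'I_n) :
    Des s \subset B -> (forall b, b \in B -> (p < b)%N = (q < b)%N) ->
  (p < q)%N -> (s p < s q)%N.
Proof.
move=> /subsetP sDB pq lt_pq.
apply: (ord_chain (R := fun a b : 'I_n => (a < b)%N) (f := s)) => //.
  by move=> a b c; apply: ltn_trans.
move=> i j def_i le_pj le_iq; case: (ltngtP (s j) (s i)) => //; last first.
  by move=> /val_inj/perm_inj eq_ij; move: def_i; rewrite eq_ij; lia.
by rewrite -(mem_Des s def_i) => /sDB/pq; lia.
Qed.

(** The blocks considered here are those cut out by the complement of [A]: all the
    positions inside them are descents. *)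
Lemma descent_in_block A s (p q : 'I_n) :
    A \subset Des s ->
    (forall b : 'I_n, (0 < b)%N -> b \notin A -> (p < b)%N = (q < b)%N) ->
  (p < q)%N -> (s q < s p)%N.
Proof.
move=> /subsetP sAD pq lt_pq.
apply: (ord_chain (R := fun a b : 'I_n => (b < a)%N) (f := s)) => //.
  by move=> a b c ? /ltn_trans; apply.
move=> i j def_i le_pj le_iq; rewrite -mem_Des //; apply: sAD.
by apply: contraT => /pq; lia.
Qed.

(** At the first position that [w] moves, it brings in a later element of the same
    block, which carries a larger value since [s] increases on blocks. *)
Lemma lexlt_young B s w :
  Des s \subset B -> w \in young_set B -> w != 1%g -> lexlt s (w * s)%g.
Proof.
move=> sDB /youngP wB /first_moved_point[p lt_p fix_p]; apply/lexltP.
exists p; last by move=> q /fix_p wq; rewrite permM wq.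
by rewrite permM; apply: (ascent_in_block sDB) => // b /wB.
Qed.

(** The mirror image of [lexlt_young]: here [s] decreases on the blocks that [w]
    preserves, so [s] is the lexicographically largest element of its coset. *)
Lemma lexlt_young_Des A B s w :
    A \subset Des s -> (forall b : 'I_n, (0 < b)%N -> b \notin A -> b \in B) ->
  w \in young_set B -> w != 1%g -> lexlt (w * s)%g s.
Proof.
move=> sAD AB /youngP wB /first_moved_point[p lt_p fix_p]; apply/lexltP.
exists p; last by move=> q /fix_p wq; rewrite permM wq.
by rewrite permM; apply: (descent_in_block sAD) => // b b0 /AB-/(_ b0)/wB.
Qed.

(** The lexicographically least element of the coset will do: a descent outside [A]
    could be removed by a transposition that stays in the coset. *)
Lemma young_coset_rep A t : exists2 w, w \in young_set A & Des (w * t)%g \subset A.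
Proof.
have W1 : 1%g \in young_set A by apply: group1.
have [w Ww min_w] := @arg_minnP _ 1%g (mem (young_set A)) (fun w => lexrank (w * t)%g) W1.
exists w => //; apply/subsetP=> i iD; apply: contraT => iA.
have [j def_i] : exists j : 'I_n, j.+1 = i.
  by move: iD; rewrite inE => /existsP[j /andP[/eqP <- _]]; exists j.
have Ww' : (tperm j i * w)%g \in young_set A.
  apply: (@groupM _ (young_group A)) => //=; apply/youngP=> p b bA.
  have neq_bi : b != i by apply: contraNneq iA => <-.
  case: tpermP => // ->; have /eqP : (b != i :> nat) by [].
    by lia.
  by lia.
have := min_w _ Ww'; rewrite leqNgt => /negP[]; apply: lexrank_lt; apply/lexltP.
exists j => [|q lt_qj].
  by rewrite -mulgA [X in (nat_of_ord X < _)%N]permM tpermL -(mem_Des _ def_i).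
by rewrite -mulgA [LHS]permM tpermD //; apply/eqP => eq_q; move: lt_qj; rewrite -eq_q; lia.
Qed.

Lemma sum_young_shift (V : zmodType) B (Y : 'S_n -> V) u :
  u \in young_set B ->
  \sum_(w in young_set B) Y (w * u)%g = \sum_(w in young_set B) Y w.
Proof.
move=> Wu; rewrite [RHS](reindex_inj (mulIg u)) /=; apply: eq_bigl => w.
by rewrite (@groupMr _ (young_group B)).
Qed.

(** A function on cosets of [W_A] takes all its values in [U] as soon as its sums
    over the larger cosets [W_(Des s) s] do.  By downward lexicographic induction:
    if [Des s] lies in [A], the sum over [W_(Des s) s] is a positive multiple of
    [Y s] plus values at lexicographically larger coset representatives. *)
Lemma young_triangular (V : lmodType rat) (U : submodClosed V) A (Y : 'S_n -> V) :
    (forall w t, w \in young_set A -> Y (w * t)%g = Y t) ->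
    (forall s, Des s \subset A -> \sum_(w in young_set (Des s)) Y (w * s)%g \in U) ->
  forall t, Y t \in U.
Proof.
move=> YA sumU t; have [w0 Ww0 DA] := young_coset_rep A t.
rewrite -(YA _ t Ww0); move: (w0 * t)%g DA => {w0 Ww0}{}t DA.
have [m] := ubnP (#|'S_n| - lexrank t); elim: m t DA => // m IHm t DA le_m.
have rank_bound u : (lexrank u <= #|'S_n|)%N.
  by rewrite /lexrank (leq_trans (max_card _)) // cardsT.
pose same w := Y (w * t)%g == Y t.
have restU : \sum_(w in young_set (Des t) | ~~ same w) Y (w * t)%g \in U.
  apply: rpred_sum => w /andP[Ww /eqP nYw].
  have [v Wv vDA] := young_coset_rep A (w * t)%g.
  rewrite -(YA _ _ Wv); apply: IHm => //.
  have Wvw : (v * w)%g \in young_set (Des t).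
    by apply: (@groupM _ (young_group _)) => //=; apply: (subsetP (young_subset DA)).
  have : lexlt t (v * w * t)%g.
    apply: (@lexlt_young (Des t)) => //; apply/eqP => vw1.
    by case: nYw; rewrite -(YA _ _ Wv) mulgA vw1 mul1g.
  move/lexrank_lt; rewrite -mulgA => lt_rank.
  have lt_t := leq_trans lt_rank (rank_bound _).
  exact: leq_trans (ltn_sub2l lt_t lt_rank) le_m.
have sameU : \sum_(w in young_set (Des t) | same w) Y (w * t)%g \in U.
  have sumD := bigID same (mem (young_set (Des t))) (fun w => Y (w * t)%g).
  rewrite -[X in X \in U](addrK (\sum_(w in young_set (Des t) | ~~ same w) Y (w * t)%g)).
  by rewrite -sumD -scaleN1r rpredD ?sumU // rpredZ.
move: sameU; rewrite (eq_bigr (fun=> Y t)) => [|w /andP[_ /eqP->] //].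
rewrite sumr_const -scaler_nat; set c := _%:R => YU.
suff c0 : c != 0 by rewrite -[Y t](scalerK c0) rpredZ.
rewrite pnatr_eq0 -lt0n; apply/card_gt0P; exists 1%g.
by rewrite unfold_in /= /same mul1g eqxx andbT; apply: (@group1 _ (young_group _)).
Qed.

End LexOrder.

(** * Weights and dominance *)

Definition pospart (z : int) : nat := if z is Posz a then a else 0%N.
Definition negpart (z : int) : nat := if z is Negz b then b.+1 else 0%N.

Lemma pos_negP z :
  z = (pospart z)%:Z - (negpart z)%:Z /\ (pospart z = 0%N \/ negpart z = 0%N).
Proof. by case: z => a /=; split; auto; lia. Qed.

Section Weights.
Variables n k : nat.
Implicit Types (d e f : 'I_n -> int) (s t u w : 'S_n) (A B : {set 'I_n}).

Definition noninc d := forall p q : 'I_n, (p <= q)%N -> d q <= d p.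

Definition breaks d : {set 'I_n} :=
  [set i : 'I_n | [exists j : 'I_n, (j.+1 == i) && (d i < d j)]].

Definition weight d := noninc d /\ forall p : 'I_n, p.+1 = k -> d p = 0.

Definition psum d (j : nat) : int := \sum_(p < n | (p < j)%N) d p.

(** Prefix sums at [k] and [n] encode the total degrees in [x] and in [y] of a weight,
    which bidominance requires to agree. *)
Definition wt_dominated d e :=
  [/\ forall j, psum d j <= psum e j, psum d k = psum e k & psum d n = psum e n].

Lemma mem_breaks d (i j : 'I_n) : j.+1 = i -> (i \in breaks d) = (d i < d j).
Proof.
move=> def_i; rewrite inE; apply/existsP/idP => [[j' /andP[/eqP def_i' lt_d]]|lt_d].
  by have -> : j = j' by apply: val_inj => /=; lia.
by exists j; rewrite def_i eqxx.
Qed.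

Lemma breaks_invariant d w p :
  noninc d -> w \in young_set (breaks d) -> d (w p) = d p.
Proof.
move=> dd /youngP wd.
have const (q r : 'I_n) : (forall b, b \in breaks d -> (q < b)%N = (r < b)%N) ->
    (q < r)%N -> d q = d r.
  move=> qr lt_qr; apply: (ord_chain (R := @eq int) (f := d)) => //.
    by move=> a b c -> ->.
  move=> i j def_i le_qj le_ir; apply/eqP; rewrite eq_sym eq_le dd ?leqW //=; last by lia.
  by rewrite leNgt -(mem_breaks d def_i); apply/negP=> /qr; lia.
case: (ltngtP p (w p)) => [lt_p|lt_p|/val_inj <- //].
  by apply/esym/const => // b /wd.
by apply: const => // b /wd.
Qed.

Lemma breaks_young d w :
  noninc d -> (forall p, d (w p) = d p) -> w \in young_set (breaks d).
Proof.
move=> dd wd; apply/youngP=> p b.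
rewrite inE => /existsP[j /andP[/eqP def_b lt_b]].
have lt_iff (q : 'I_n) : (q < b)%N = (d b < d q).
  apply/idP/idP => [lt_qb | ].
    by apply: lt_le_trans lt_b (dd _ _ _); lia.
  by apply: contraTT; rewrite -leqNgt -leNgt; apply: dd.
by rewrite !lt_iff wd.
Qed.

Lemma noninc_step d :
  (forall i j : 'I_n, j.+1 = i -> d i <= d j) -> noninc d.
Proof.
move=> dstep p q; rewrite leq_eqVlt => /orP[/eqP/val_inj -> //|lt_pq].
apply: (ord_chain (R := fun a b : int => b <= a) (f := d)) => // [a b c ab bc|i j /dstep //].
exact: le_trans bc ab.
Qed.

(** Prefix sums of a rearrangement are bounded by those of the sorted function: with
    [c] the [j]-th largest value, any [j] values sum to at most [j * c] plus the sum
    of the positive parts of all [d p - c], with equality for the first [j]. *)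
Lemma psum_perm_le d u j : noninc d -> psum (d \o u) j <= psum d j.
Proof.
move=> dd; case: (posnP j) => [->|j_gt0].
  by rewrite /psum !big_pred0 // => p; rewrite ltn0.
case: (ltnP n j) => [lt_nj|le_jn].
  have all_lt (p : 'I_n) : (p < j)%N by apply: ltn_trans (ltn_ord p) lt_nj.
  rewrite /psum (eq_bigl xpredT) // [leRHS](eq_bigl xpredT) //.
  by rewrite [leRHS](reindex_inj (@perm_inj _ u)).
have lt_jn : (j.-1 < n)%N by lia.
(* the [j]-th largest value of [d] *)
pose c := d (Ordinal lt_jn).
apply: (@le_trans _ _ (\sum_(p < n | (p < j)%N) (c + Num.max (d (u p) - c) 0))).
  by apply: ler_sum => p _ /=; rewrite -lerBlDl le_max lexx.
rewrite big_split /=.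
apply: (@le_trans _ _ (\sum_(p < n | (p < j)%N) c + \sum_p Num.max (d p - c) 0)).
  rewrite lerD2l [leRHS](reindex_inj (@perm_inj _ u)) /=.
  rewrite [leRHS](bigID (fun p : 'I_n => (p < j)%N)) /= lerDl.
  by apply: sumr_ge0 => p _; rewrite le_max lexx orbT.
rewrite [X in _ + X](bigID (fun p : 'I_n => (p < j)%N)) /=.
rewrite [X in _ + (_ + X)]big1 ?addr0 => [|p]; last first.
  rewrite -leqNgt => le_jp; apply: max_r; rewrite subr_le0.
  by apply: dd => /=; lia.
rewrite -big_split /=; apply: ler_sum => p lt_pj.
rewrite max_l ?subrKC ?lexx // subr_ge0; apply: dd => /=; lia.
Qed.

Lemma psumS d (p : 'I_n) : psum d p.+1 = psum d p + d p.
Proof.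
rewrite /psum (bigD1 p) //= addrC; congr (_ + _).
by apply: eq_bigl => q; rewrite -val_eqE /=; lia.
Qed.

Lemma psum_inj d e : psum d =1 psum e -> d =1 e.
Proof. by move=> eq_de p; have := eq_de p.+1; rewrite !psumS eq_de => /addrI. Qed.

Lemma psum_ext d e : d =1 e -> psum d =1 psum e.
Proof. by move=> eq_de j; apply: eq_bigr => p _. Qed.

Lemma psumD d e j : psum (fun p => d p + e p) j = psum d j + psum e j.
Proof. exact: big_split. Qed.

(** If the prefix sums of rearrangements of [d] and [e] add up to those of the sorted
    functions, then each of them was already sorted. *)
Lemma psum_split_eq d e u w : noninc d -> noninc e ->
    (forall j, psum d j + psum e j <= psum (d \o u) j + psum (e \o w) j) ->
  (forall p, d (u p) = d p) /\ (forall p, e (w p) = e p).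
Proof.
move=> dd de le_sum.
have le_d j : psum (d \o u) j <= psum d j by apply: psum_perm_le.
have le_e j : psum (e \o w) j <= psum e j by apply: psum_perm_le.
split; [apply: (@psum_inj (d \o u) d) | apply: (@psum_inj (e \o w) e)] => j;
  by have := le_sum j; have := le_d j; have := le_e j; lia.
Qed.

Lemma wt_dominated_refl d : wt_dominated d d.
Proof. by split. Qed.

Lemma wt_dominated_trans d e f : wt_dominated d e -> wt_dominated e f -> wt_dominated d f.
Proof.
move=> [le_de dek den] [le_ef efk efn].
by split=> [j||]; [apply: le_trans (le_ef j) | rewrite dek | rewrite den].
Qed.

Lemma psum_all d : psum d n = \sum_p d p.
Proof. by apply: eq_bigl => p; rewrite ltn_ord. Qed.

Lemma psum_all_perm d u : psum (d \o u) n = psum d n.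
Proof. by rewrite !psum_all [RHS](reindex_inj (@perm_inj _ u)). Qed.

Lemma weight_ge0 d (p : 'I_n) : (0 < k <= n)%N -> weight d -> (p < k)%N -> 0 <= d p.
Proof.
move=> hk [dd d0] lt_pk; have lt_kn : (k.-1 < n)%N by lia.
have /dd : (p <= Ordinal lt_kn)%N by rewrite /=; lia.
by rewrite [d (Ordinal _)]d0 //=; lia.
Qed.

Lemma weight_le0 d (p : 'I_n) : (0 < k <= n)%N -> weight d -> (k <= p.+1)%N -> d p <= 0.
Proof.
move=> hk [dd d0] le_kp; have lt_kn : (k.-1 < n)%N by lia.
have /dd : (Ordinal lt_kn <= p)%N by rewrite /=; lia.
by rewrite [d (Ordinal _)]d0 //=; lia.
Qed.

(** The prefix up to the position where a weight vanishes is its degree in [x], a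
    quantity that does not depend on the order of the indices. *)
Lemma psum_pos d :
  (0 < k <= n)%N -> weight d -> psum d k = \sum_p (pospart (d p))%:Z.
Proof.
move=> hk dW; rewrite /psum big_mkcond; apply: eq_bigr => p _.
case: ltnP => [/(weight_ge0 hk dW)|le_kp]; first by case: (d p).
have := weight_le0 hk dW (leqW le_kp).
by case: (d p) => //= a; rewrite lez_nat leqn0 => /eqP->.
Qed.

Lemma sort_perm e : exists t, noninc (e \o t).
Proof.
pose T := [tuple e i | i < n].
have /tuple_permP[t eq_t] : perm_eq (sort >=%R T) T by rewrite perm_sort.
exists t => p q le_pq /=.
have nthT (i : 'I_n) : nth 0 (sort >=%R T) i = e (t i).
  by rewrite eq_t nth_mktuple tnth_mktuple.
rewrite -!nthT.
have ge_tr : transitive (>=%R : rel int) by move=> a b c ba cb; apply: le_trans cb ba.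
have ge_refl : reflexive (>=%R : rel int) by move=> a; apply: lexx.
have sortedT : sorted >=%R (sort >=%R T).
  by apply: sort_sorted => a b; apply: le_total.
by apply: (sorted_leq_nth ge_tr ge_refl 0 sortedT); rewrite ?inE ?size_sort ?size_tuple.
Qed.

(** Each element [j < k] adds one to the [x]-exponents of the first [j] positions,
    and each element [j >= k] one to the [y]-exponents, hence minus one here, of the
    positions from [j] on. *)
Definition wt A (p : 'I_n) : int :=
  \sum_(j in A) ((p < j)%N%:R - (k <= j)%N%:R).

Lemma wt_step A (i j : 'I_n) : j.+1 = i -> wt A j = wt A i + (i \in A)%:R.
Proof.
move=> def_i; rewrite /wt; apply/eqP; rewrite -subr_eq0 opprD addrA -sumrB subr_eq0.
apply/eqP; case: (boolP (i \in A)) => [iA|iA].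
  rewrite (bigD1 i) //= big1 => [|l /andP[lA /eqP neq_l]].
    by rewrite ltnn def_i leqnn; lia.
  have neq_li : l <> i :> nat by move/val_inj.
  have -> : (j < l)%N = (i < l)%N by lia.
  by rewrite subrr.
rewrite big1 => // l lA.
have neq_li : l <> i :> nat by move=> /val_inj eq_l; rewrite -eq_l lA in iA.
have -> : (j < l)%N = (i < l)%N by lia.
by rewrite subrr.
Qed.

Lemma wt_weight A : weight (wt A).
Proof.
split=> [|p def_k]; last by rewrite /wt big1 // => j _; rewrite -def_k subrr.
by apply: noninc_step => i j /(wt_step A) ->; rewrite lerDl.
Qed.

Lemma breaks_wt A : (forall i, i \in A -> (0 < i)%N) -> breaks (wt A) = A.
Proof.
move=> A0; apply/setP=> i; apply/idP/idP => [|iA].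
  rewrite inE => /existsP[j /andP[/eqP def_i]].
  by rewrite (wt_step A def_i) ltrDl; case: (i \in A).
have i0 := A0 i iA; have lt_i : (i.-1 < n)%N by have := ltn_ord i; lia.
have def_i : (Ordinal lt_i).+1 = i by rewrite /=; lia.
by rewrite (mem_breaks _ def_i) (wt_step A def_i) iA ltrDl.
Qed.

(** The weight of the monomials of Delta. *)
Definition staircase (p : 'I_n) : int := k%:Z - 1 - p%:Z.

Lemma stair_step (i j : 'I_n) : j.+1 = i -> staircase j = staircase i + 1.
Proof. by rewrite /staircase; lia. Qed.

Lemma stair_inj : injective staircase.
Proof. by move=> p q; rewrite /staircase => ?; apply: val_inj => /=; lia. Qed.

End Weights.

(** * Monomials attached to integer functions *)

Section Monomials.
Variable n : nat.
Implicit Types (d e f g : 'I_n -> int) (s t u w : 'S_n) (m : 'X_{1..n + n}).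

Definition mon e : 'X_{1..n + n} :=
  [multinom match split i with inl j => pospart (e j) | inr j => negpart (e j) end
     | i < n + n].

(** The weight [d] read along [t]: the index [t p] carries the exponent [d p]. *)
Definition mon_along d t : 'X_{1..n + n} := mon (fun i => d (t^-1%g i)).

Lemma mon_l e i : mon e (lshift n i) = pospart (e i).
Proof. by rewrite mnmE (unsplitK (inl i)). Qed.

Lemma mon_r e i : mon e (rshift n i) = negpart (e i).
Proof. by rewrite mnmE (unsplitK (inr i)). Qed.

Lemma mnmP2 m m' :
  (forall i, m (lshift n i) = m' (lshift n i) /\ m (rshift n i) = m' (rshift n i)) ->
  m = m'.
Proof.
by move=> eq_m; apply/mnmP=> i; rewrite -[i]splitK; case: split => j /=; case: (eq_m j).
Qed.

Lemma eq_mon e f : e =1 f -> mon e = mon f.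
Proof. by move=> eq_ef; apply: mnmP2 => i; rewrite !mon_l !mon_r eq_ef. Qed.

Lemma mon_inj e f : mon e = mon f -> e =1 f.
Proof.
move=> eq_m i; have [-> _] := pos_negP (e i); have [-> _] := pos_negP (f i).
by rewrite -!mon_l -!mon_r eq_m.
Qed.

(** A divisor of a monomial without mixed indices has none either, and exponents then
    subtract as integers. *)
Lemma mon_dvd e m g : (mon e + m)%MM = mon g ->
  exists f, [/\ m = mon f, forall i, g i = e i + f i,
   forall i, (pospart (f i) <= pospart (g i))%N
     & forall i, (negpart (f i) <= negpart (g i))%N].
Proof.
move=> eq_m; pose f i : int := (m (lshift n i))%:Z - (m (rshift n i))%:Z.
have parts i : pospart (g i) = (pospart (e i) + m (lshift n i))%N /\
               negpart (g i) = (negpart (e i) + m (rshift n i))%N.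
  by rewrite -!mon_l -!mon_r -eq_m !mnmDE.
have f_parts i : pospart (f i) = m (lshift n i) /\ negpart (f i) = m (rshift n i).
  have [] := parts i; have [_ g0] := pos_negP (g i).
  have := pos_negP (f i); rewrite /f; lia.
exists f; split=> [|i|i|i].
- by apply: mnmP2 => i; rewrite mon_l mon_r; have [-> ->] := f_parts i.
- by have := pos_negP (g i); have := pos_negP (e i); have := parts i; rewrite /f; lia.
- by have := parts i; have := f_parts i; lia.
by have := parts i; have := f_parts i; lia.
Qed.

Lemma mon_dvd2 e f m g : (mon e + mon f + m)%MM = mon g ->
  (mon e + mon f)%MM = mon (fun i => e i + f i).
Proof.
move=> eq_m; apply: mnmP2 => i; rewrite !mnmDE !mon_l !mon_r.
have : pospart (g i) = (pospart (e i) + pospart (f i) + m (lshift n i))%N /\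
       negpart (g i) = (negpart (e i) + negpart (f i) + m (rshift n i))%N.
  by rewrite -!mon_l -!mon_r -eq_m !mnmDE.
have := pos_negP (g i); have := pos_negP (e i); have := pos_negP (f i).
have := pos_negP (e i + f i); lia.
Qed.

Lemma monD e f : (forall i, (0 <= e i) && (0 <= f i) || (e i <= 0) && (f i <= 0)) ->
  (mon e + mon f)%MM = mon (fun i => e i + f i).
Proof.
move=> same; apply: mnmP2 => i; rewrite !mnmDE !mon_l !mon_r.
have := pos_negP (e i); have := pos_negP (f i).
have := pos_negP (e i + f i); have := same i; lia.
Qed.

Lemma diag_perm_l s i : diag_perm s (lshift n i) = lshift n (s i).
Proof. by rewrite permE /diag_fun (unsplitK (inl i)). Qed.

Lemma diag_perm_r s i : diag_perm s (rshift n i) = rshift n (s i).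
Proof. by rewrite permE /diag_fun (unsplitK (inr i)). Qed.

(** The action on exponents dual to the diagonal action on polynomials. *)
Definition exp_perm s m : 'X_{1..n + n} := [multinom m (diag_perm s i) | i < n + n].

Lemma exp_permE s m i : exp_perm s m i = m (diag_perm s i).
Proof. exact: mnmE. Qed.

Lemma exp_perm_inj s : injective (exp_perm s).
Proof.
move=> m m' eq_m; apply/mnmP=> i; have /mnmP/(_ ((diag_perm s)^-1%g i)) := eq_m.
by rewrite !exp_permE permKV.
Qed.

Lemma exp_perm_mon_along d t s : exp_perm s (mon_along d (t * s)) = mon_along d t.
Proof.
apply: mnmP2 => i; rewrite !exp_permE diag_perm_l diag_perm_r !mon_l !mon_r.
by rewrite invMg !permM permK.
Qed.

Lemma mcoeff_act s (p : {mpoly rat[n + n]}) m : (poly_act s p)@_m = p@_(exp_perm s m).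
Proof. exact: mcoeff_sym. Qed.

Lemma mon_along_act d t s : poly_act s 'X_[mon_along d t] = 'X_[mon_along d (t * s)].
Proof.
apply/mpolyP=> m; rewrite mcoeff_act !mcoeffX -(exp_perm_mon_along d t s).
by rewrite (inj_eq (@exp_perm_inj s)).
Qed.

End Monomials.

(** * Coefficients of Delta and the pairing *)

Section DeltaCoefficients.
Variables n k : nat.
Hypothesis hk : (0 < k <= n)%N.
Implicit Types (d e : 'I_n -> int) (s t u w : 'S_n) (m : 'X_{1..n + n}).
Local Notation Delta := (Delta n k).
Local Notation stair := (@staircase n k).
Local Notation J := (@Jideal n k).

(** The columns of the matrix of Delta are ordered [1, y, y^2, ...] and then
    [x, x^2, ...]; this is the position at which the staircase takes the exponent of
    column [j]. *)
Definition column_pos (j : 'I_n) : 'I_n :=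
  insubd j (if (j <= n - k)%N then (k.-1 + j)%N else (n.-1 - j)%N).

Lemma val_column_pos j :
  column_pos j = (if (j <= n - k)%N then (k.-1 + j)%N else (n.-1 - j)%N) :> nat.
Proof.
by rewrite val_insubd ifT //; have := ltn_ord j; case: ifP; lia.
Qed.

Lemma column_pos_inj : injective column_pos.
Proof.
move=> i j /(congr1 val); rewrite /= !val_column_pos => eq_ij; apply: val_inj => /=.
by have := ltn_ord i; have := ltn_ord j; move: eq_ij; do 2!case: ifP; lia.
Qed.

Definition column_perm : 'S_n := perm column_pos_inj.

Lemma monomial_prod e :
  'X_[mon e] = \prod_i (xvar i ^+ pospart (e i) * yvar i ^+ negpart (e i))
    :> {mpoly rat[n + n]}.
Proof.
rewrite mpolyXE_id big_split_ord /= big_split /=; congr (_ * _).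
  by apply: eq_bigr => i _; rewrite mon_l.
by apply: eq_bigr => i _; rewrite mon_r.
Qed.

Lemma Delta_expand :
  Delta = \sum_(t : 'S_n) ((-1) ^+ (t^-1 * column_perm^-1)%g) *: 'X_[mon_along stair t].
Proof.
rewrite /Defs.Delta /determinant.
have h_inj : injective (fun t : 'S_n => (t^-1 * column_perm^-1)%g).
  by move=> s t /mulIg/invg_inj.
rewrite (reindex_inj h_inj) /=; apply: eq_bigr => t _.
rewrite -mul_mpolyC rmorphXn rmorphN rmorph1; congr (_ * _).
rewrite monomial_prod; apply: eq_bigr => i _; rewrite permM mxE.
set p := (t^-1)%g i; set j := (column_perm^-1)%g p.
have -> : p = column_pos j by rewrite -[RHS](permE column_pos_inj) permKV.
rewrite /staircase val_column_pos; case: ifP => le_j.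
  have -> : k%:Z - 1 - (k.-1 + j)%N%:Z = - j%:Z by lia.
  by case: (val j) => [|l] /=; rewrite ?expr0 !mul1r.
have lt_j := ltn_ord j.
have -> : k%:Z - 1 - (n.-1 - j)%N%:Z = (j - (n - k))%N%:Z by lia.
by rewrite /= expr0 mulr1.
Qed.

Lemma mon_along_stair_inj s t : mon_along stair s = mon_along stair t -> s = t.
Proof.
move/mon_inj=> eq_st; apply/invg_inj/permP => i.
exact/stair_inj/eq_st.
Qed.

Lemma Delta_support m : Delta@_m != 0 -> exists t, m = mon_along stair t.
Proof.
rewrite Delta_expand raddf_sum /= => sum0.
suff /existsP[t /eqP->] : [exists t, m == mon_along stair t] by exists t.
apply: contraNT sum0 => /existsPn neq_m; rewrite big1 // => t _.
by rewrite mcoeffZ mcoeffX eq_sym (negbTE (neq_m t)) mulr0.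
Qed.

Lemma Delta_stair t : Delta@_(mon_along stair t) != 0.
Proof.
rewrite Delta_expand raddf_sum /= (bigD1 t) //= big1 => [|s neq_st].
  by rewrite mcoeffZ mcoeffX eqxx mulr1 addr0 signr_eq0.
rewrite mcoeffZ mcoeffX; case: eqP => [/mon_along_stair_inj eq_st|_]; last by rewrite mulr0.
by rewrite eq_st eqxx in neq_st.
Qed.

Lemma Delta_act s m : Delta@_(exp_perm s m) = (-1) ^+ s * Delta@_m.
Proof. by rewrite -mcoeff_act poly_act_Delta mcoeffZ. Qed.

Lemma mfact_mon_along d t : mfact (mon_along d t) = mfact (mon d).
Proof.
rewrite /mfact !big_split_ord /=; congr (_ * _)%N.
  rewrite [RHS](reindex_inj (@perm_inj _ t^-1%g)) /=.
  by apply: eq_bigr => i _; rewrite !mon_l.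
rewrite [RHS](reindex_inj (@perm_inj _ t^-1%g)) /=.
by apply: eq_bigr => i _; rewrite !mon_r.
Qed.

Lemma mfact_neq0 m : (mfact m)%:R != 0 :> rat.
Proof. by rewrite pnatr_eq0 -lt0n prodn_gt0 // => i; apply: fact_gt0. Qed.

Definition pair_with (h f : {mpoly rat[n + n]}) : rat^o := pairing f h.
HB.instance Definition _ h :=
  GRing.isLinear.Build rat {mpoly rat[n + n]} rat^o *:%R (pair_with h)
    (@pairing_linearl n h).

Lemma pair_withB h f g : pair_with h (f - g) = pair_with h f - pair_with h g.
Proof. exact: raddfB. Qed.

(** All monomials of Delta have the same factorial, so the pairing sees only a
    coefficient of Delta, up to a nonzero constant that does not depend on [g] and
    [m]. *)
Lemma pair_DeltaX m g :
  pair_with Delta^`M[m] 'X_[g] = (mfact (mon stair))%:R * Delta@_(m + g).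
Proof.
rewrite /pair_with pairingE msuppX big_seq1 mcoeffX eqxx mul1r mcoeff_mderivm.
have [->|/Delta_support[t def_t]] := eqVneq (Delta@_(m + g)) 0.
  by rewrite !mul0rn mulr0.
rewrite -mulrnA -[LHS]mulr_natl; congr (_%:R * _).
rewrite -(mfact_mon_along _ t) -def_t /mfact -big_split /=; apply: eq_bigr => i _.
by rewrite mnmDE -(@ffact_fact (m i + g i) (m i)) ?leq_addr // addKn.
Qed.

Lemma pair_Delta_sum m (I : finType) (P : pred I) (c : I -> rat) (g : I -> 'X_{1..n + n}) :
  pair_with Delta^`M[m] (\sum_(i | P i) c i *: 'X_[g i]) =
    (mfact (mon stair))%:R * \sum_(i | P i) c i * Delta@_(m + g i).
Proof.
rewrite linear_sum mulr_sumr; apply: eq_bigr => i _.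
rewrite linearZ -[RHS]mulrCA; congr (_ * _); exact: pair_DeltaX.
Qed.

Lemma Jideal_pair f : (forall m, pair_with Delta^`M[m] f = 0) -> f \in J.
Proof.
move=> f0; apply/JidealP => h /lspanP[r [c [w [Hw ->]]]].
rewrite pairingE; under eq_bigr => m _ do
  rewrite raddf_sum /= -sumrMnl mulr_sumr.
rewrite exchange_big /= big1 // => i _; have [m ->] := Hw i.
transitivity (c i * pair_with Delta^`M[m] f); last by rewrite f0 mulr0.
rewrite /pair_with pairingE mulr_sumr; apply: eq_bigr => l _.
by rewrite mcoeffZ mulrCA -mulrnAr.
Qed.

Lemma pair_Jideal f m : f \in J -> pair_with Delta^`M[m] f = 0.
Proof. by move/JidealP; apply; apply: lspan_gen; exists m. Qed.

Lemma JidealX g : (forall m, Delta@_(m + g) = 0) -> 'X_[g] \in J.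
Proof. by move=> g0; apply: Jideal_pair => m; rewrite pair_DeltaX g0 mulr0. Qed.

End DeltaCoefficients.

(** * Symmetrisations in the ideal *)

Section JRelations.
Variables n k : nat.
Hypothesis hk : (0 < k <= n)%N.
Implicit Types (d e f : 'I_n -> int) (s t u w : 'S_n) (m g : 'X_{1..n + n}).
Local Notation Delta := (Delta n k).
Local Notation stair := (@staircase n k).
Local Notation J := (@Jideal n k).

(** The exponents of the staircase are the cells of the hook, which are closed under
    division; [n] distinct cells below them are all of them. *)
Lemma sub_stair_distinct f :
    (forall i, exists p, (pospart (f i) <= pospart (stair p))%N /\
                         (negpart (f i) <= negpart (stair p))%N) ->
    injective f ->
  exists v : 'S_n, forall i, f i = stair (v i).
Proof.
move=> f_le f_inj.
pose q i : 'I_n := insubd i (absz (k%:Z - 1 - f i)%R).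
have fE i : f i = stair (q i).
  have [p [le_pos le_neg]] := f_le i.
  have lt_p := ltn_ord p; move: le_pos le_neg (pos_negP (f i)) (pos_negP (stair p)).
  rewrite /q /staircase val_insubd => le_pos le_neg stp fi.
  by rewrite ifT; lia.
have q_inj : injective q by move=> i j eq_q; apply: f_inj; rewrite !fE eq_q.
by exists (perm q_inj) => i; rewrite permE.
Qed.

(** Pair with the derivative of Delta by [m] and put [m' = m + g].  If [m'] has the
    same exponents at two indices, their transposition fixes [m'] and reverses the
    sign of Delta, so the sum over [w] is its own opposite.  Otherwise a monomial of
    Delta divisible by [m'] has to be [m'] itself, by [sub_stair_distinct], which
    leaves no room for a nonzero [e]. *)
Lemma orbit_sum_Jideal e g :
  (exists i, e i != 0) -> \sum_(w : 'S_n) 'X_[(g + mon_along e w)%MM] \in J.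
Proof.
move=> e_neq0; apply: Jideal_pair => m; rewrite linear_sum /=.
under eq_bigr => w _ do rewrite pair_DeltaX // addmA.
rewrite -mulr_sumr; move: (m + g)%MM => m'; apply/eqP; rewrite mulf_eq0; apply/orP; right.
have [[i [j [neq_ij eq_l eq_r]]]|distinct] := pselect (exists i j : 'I_n, [/\ i != j,
    m' (lshift n i) = m' (lshift n j) & m' (rshift n i) = m' (rshift n j)]).
  pose t := tperm i j.
  have fix_l l : m' (lshift n (t l)) = m' (lshift n l).
    by rewrite /t; case: tpermP => [->|->|].
  have fix_r l : m' (rshift n (t l)) = m' (rshift n l).
    by rewrite /t; case: tpermP => [->|->|].
  have : \sum_(w : 'S_n) Delta@_(m' + mon_along e w) =
            - \sum_(w : 'S_n) Delta@_(m' + mon_along e w).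
    rewrite [LHS](reindex_inj (mulIg t)) -sumrN; apply: eq_bigr => w _.
    rewrite -[RHS]mulN1r -[-1]expr1.
    have -> : (1 = odd_perm t :> nat)%N by rewrite odd_tperm neq_ij.
    rewrite -Delta_act; congr (_@_ _); apply: mnmP2 => l.
    rewrite !exp_permE !mnmDE diag_perm_l diag_perm_r fix_l fix_r.
    by rewrite !mon_l !mon_r invMg permM tpermV.
  by move/eqP; rewrite eq_sym eqNr.
rewrite big1 // => w _; apply/eqP/contraT => /(Delta_support hk)[t].
rewrite addmC => /mon_dvd[f [eq_m' eq_f le_pos le_neg]]; exfalso.
have f_inj : injective f.
  move=> i j eq_ij; apply/eqP/contraT => neq_ij; case: distinct; exists i, j.
  by rewrite eq_m' !mon_l !mon_r eq_ij.
have [v fE] : exists v : 'S_n, forall i, f i = stair (v i).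
  by apply: sub_stair_distinct => // i; exists (t^-1%g i).
have sum_perm (F : int -> nat) u :
    (\sum_i F (stair (u i)) = \sum_i F (stair i))%N.
  by rewrite [RHS](reindex_inj (@perm_inj _ u)).
have eq_part (F : int -> nat) : (forall i, (F (f i) <= F (stair (t^-1%g i)))%N) ->
    forall i, F (f i) = F (stair (t^-1%g i)).
  move=> le_F i; have [_] := leqif_sum (fun (l : 'I_n) (_ : true) => leqif_eq (le_F l)).
  under eq_bigr => l _ do rewrite fE.
  by rewrite !sum_perm eqxx => /esym/forallP/(_ i)/eqP.
have eq_pos := eq_part _ le_pos; have eq_neg := eq_part _ le_neg.
have [i] := e_neq0; case/negP; apply/eqP.
have := eq_f (w i). have := eq_pos (w i). have := eq_neg (w i).
have := pos_negP (f (w i)); have := pos_negP (stair (t^-1%g (w i))).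
rewrite permK; lia.
Qed.
End JRelations.

(** * Coset sums of monomials *)

Section Straightening.
Variables n k : nat.
Hypothesis hk : (0 < k <= n)%N.
Implicit Types (d e f : 'I_n -> int) (s t u w : 'S_n) (m g : 'X_{1..n + n})
  (A : {set 'I_n}).
Local Notation Delta := (Delta n k).
Local Notation stair := (@staircase n k).
Local Notation wt := (@wt n k).
Local Notation weight := (@weight n k).
Local Notation wt_dominated := (@wt_dominated n k).
Local Notation J := (@Jideal n k).

Lemma perm_not_shrink (v : 'S_n) (S T : {set 'I_n}) :
  T \proper S -> ~ (forall p, p \in S -> v p \in T).
Proof.
move=> /proper_card lt_TS vST; have : v @: S \subset T.
  by apply/subsetP=> _ /imsetP[p pS ->]; apply: vST.
move/subset_leq_card; rewrite card_imset; last exact: perm_inj.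
by rewrite leqNgt lt_TS.
Qed.

(** A divisor of a monomial of Delta has fewer than [k] indices with an [x] and at
    most [n - k] with a [y], so that sorting it puts a zero at position [k - 1]. *)
Lemma weight_of_divisor e m t u :
  (mon e + m)%MM = mon_along stair t -> noninc (e \o u) -> weight (e \o u).
Proof.
move=> /mon_dvd[f [_ eq_f le_pos le_neg]] de; split=> // p def_k.
have parts q := (eq_f (u q), le_pos (u q), le_neg (u q),
  pos_negP (e (u q)), pos_negP (f (u q)), pos_negP (stair (t^-1%g (u q)))).
case: (ltgtP ((e \o u) p) 0) => // sgn_e; exfalso.
  apply: (@perm_not_shrink (u * t^-1)%g
    [set q : 'I_n | (p <= q)%N] [set q : 'I_n | (p < q)%N]).
    apply/properP; split; first by apply/subsetP=> q; rewrite !inE; apply: ltnW.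
    by exists p; rewrite !inE ?ltnn.
  move=> q; rewrite !inE permM => le_pq; have := de p q le_pq; have [[[[[]]]]] := parts q.
  by rewrite /= in sgn_e *; rewrite /staircase; lia.
apply: (@perm_not_shrink (u * t^-1)%g
  [set q : 'I_n | (q <= p)%N] [set q : 'I_n | (q < p)%N]).
  apply/properP; split; first by apply/subsetP=> q; rewrite !inE; apply: ltnW.
  by exists p; rewrite !inE ?ltnn.
move=> q; rewrite !inE permM => le_pq; have := de q p le_pq; have [[[[[]]]]] := parts q.
by rewrite /= in sgn_e *; rewrite /staircase; lia.
Qed.

Lemma weightB d A : weight d -> A \subset breaks d -> weight (fun p => d p - wt A p).
Proof.
move=> [dd d0] /subsetP sAd; split=> [|p def_k]; last first.
  by rewrite d0 // (proj2 (wt_weight k A)) // subrr.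
apply: noninc_step => i j def_i; rewrite (wt_step k A def_i).
case: (boolP (i \in A)) => [/sAd|_]; rewrite ?(mem_breaks _ def_i).
  by move=> lt_d; rewrite opprD addrCA addrC lerD2r; lia.
by rewrite addr0 lerD2r dd // -def_i.
Qed.

Lemma mon_along_young d u t : noninc d -> u \in young_set (breaks d) ->
  mon_along d (u * t)%g = mon_along d t.
Proof.
move=> dd Wu; apply: eq_mon => i; rewrite invMg permM.
apply: breaks_invariant => //; exact: (@groupVr _ (young_group _)).
Qed.

Lemma mon_alongD d e t : weight d -> weight e ->
  (mon_along d t + mon_along e t)%MM = mon_along (fun p => d p + e p) t.
Proof.
move=> dW eW; apply: monD => i; set p := t^-1%g i.
have [lt_pk|le_kp] := ltnP p k.
  by rewrite (weight_ge0 hk dW) ?(weight_ge0 hk eW).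
by rewrite (weight_le0 hk dW) ?(weight_le0 hk eW) ?orbT ?leqW.
Qed.

Definition mono_class d t : Hquot n k := \pi_(Hquot n k) 'X_[mon_along d t].

Lemma eq_mono_class d e t : d =1 e -> mono_class d t = mono_class e t.
Proof. by move=> eq_de; congr (\pi_ _ 'X_[_]); apply: eq_mon => i; apply: eq_de. Qed.

Lemma mono_class_act s d t : Hquot_act s (mono_class d t) = mono_class d (t * s)%g.
Proof. by rewrite Hquot_actE mon_along_act. Qed.

Lemma mono_class_young d u t : noninc d -> u \in young_set (breaks d) ->
  mono_class d (u * t)%g = mono_class d t.
Proof. by move=> dd Wu; rewrite /mono_class mon_along_young. Qed.

Lemma pi_Jideal p : p \in J -> \pi_(Hquot n k) p = 0.
Proof.
by move=> pJ; apply/eqP; rewrite -[0](raddf0 \pi_(Hquot n k)) eq_lquot subr0.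
Qed.

Definition lower_span d : {pred Hquot n k} := lspan (fun v => exists d' t,
  [/\ weight d', wt_dominated d' d, ~ d' =1 d & v = mono_class d' t]).
HB.instance Definition _ d := GRing.SubmodClosed.on (lower_span d).

(** A term of the product is killed by [J], or its weight is dominated by [d + e];
    equality forces a single permutation [t] to sort both factors, which is what the
    hypothesis excludes. *)
Lemma product_lower d e s w :
    weight d -> weight e ->
    (forall t, (t * s^-1)%g \in young_set (breaks d) ->
               (t * w^-1)%g \notin young_set (breaks e)) ->
  \pi_(Hquot n k) 'X_[(mon_along d s + mon_along e w)%MM] \in lower_span (fun p => d p + e p).
Proof.
move=> dW eW no_t; have [dd de] := (proj1 dW, proj1 eW).
have [[m nz]|zero] :=
    pselect (exists m, Delta@_(m + (mon_along d s + mon_along e w)) != 0); last first.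
  rewrite pi_Jideal ?rpred0 //; apply: JidealX => // m; apply/eqP/contraT => nz.
  by case: zero; exists m.
(* some multiple of the product occurs in Delta: no index is mixed, and the
   exponents add up as integers *)
have [r] := Delta_support hk nz; rewrite addmC => eq_m.
pose f i := d (s^-1%g i) + e (w^-1%g i).
have eq_g : (mon_along d s + mon_along e w)%MM = mon f by apply: mon_dvd2 eq_m.
have [t ft] := sort_perm f.
rewrite eq_g in eq_m *; have ftW := weight_of_divisor eq_m ft.
have psum_f j : psum (f \o t) j = psum (d \o (t * s^-1)%g) j + psum (e \o (t * w^-1)%g) j.
  by rewrite -psumD; apply: psum_ext => p; rewrite /f /= !permM.
apply: lspan_gen; exists (f \o t), t; split=> //; last first.
- congr (\pi_ _ 'X_[_]).
  by apply: eq_mon => i; rewrite /= permKV.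
- move=> eq_f; have [|ds es] := @psum_split_eq n d e (t * s^-1)%g (t * w^-1)%g dd de.
    by move=> j; rewrite -psum_f -psumD (psum_ext eq_f).
  by have /negP[] := no_t t (breaks_young dd ds); apply: breaks_young.
split=> [j||].
- by rewrite psum_f psumD lerD // psum_perm_le.
- have pos_perm h (v : 'S_n) :
      \sum_p (pospart ((h \o v) p))%:Z = \sum_p (pospart (h p))%:Z.
    by rewrite [RHS](reindex_inj (@perm_inj _ v)).
  rewrite psumD !(psum_pos hk) // pos_perm -(pos_perm d s^-1%g) -(pos_perm e w^-1%g).
  rewrite -big_split /=; apply: eq_bigr => i _.
  by rewrite -[in LHS]mon_l -eq_g mnmDE !mon_l PoszD.
by rewrite psum_f psumD !psum_all_perm.
Qed.

(** Multiply the monomial of [b = wt (Des s)] along [s] by the symmetrisation of the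
    monomial of [e = d - b]; the product vanishes in the quotient.  Its terms of
    weight [d] are the monomials of weight [d] along [W_(Des s) s], all with the same
    multiplicity, and [product_lower] deals with the other terms. *)
Lemma young_sum_lower d s :
    weight d -> Des s \subset breaks d -> ~ d =1 wt (Des s) ->
  \sum_(v in young_set (Des s)) mono_class d (v * s)%g \in lower_span d.
Proof.
move=> dW sDd neq_d; pose b := wt (Des s); pose e p := d p - b p.
have bW : weight b := wt_weight k _.
have eW : weight e by apply: weightB.
have [db de] := (proj1 bW, proj1 eW).
have brk_b : breaks b = Des s by apply: breaks_wt => i; apply: Des_gt0.
have eq_be : (fun p => b p + e p) =1 d by move=> p; rewrite /e subrKC.
have e_neq0 : exists i, e i != 0.
  apply: contrapT => e0; apply: neq_d => p; apply/eqP; rewrite -subr_eq0.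
  by apply/negP => nz; apply: e0; exists p; apply/negP.
pose W := young_group (Des s); pose We := young_group (breaks e).
pose term w : {mpoly rat[n + n]} := 'X_[(mon_along b s + mon_along e w)%MM].
(* the number of elements of [W s] along which the term of [w] has weight [d] *)
pose N w := #|[set v in W | (w * (v * s)^-1)%g \in We]|.
have sum_term : \sum_(w : 'S_n) \pi_(Hquot n k) (term w) = 0.
  by rewrite -raddf_sum; apply: pi_Jideal; apply: orbit_sum_Jideal.
have termE u v : u \in We -> v \in W ->
    \pi_(Hquot n k) (term (u * (v * s))%g) = mono_class d (v * s)%g.
  move=> Wu Wv; rewrite /term -(@mon_along_young b v s) // ?brk_b //.
  by rewrite (@mon_along_young e u) // mon_alongD //; apply: eq_mono_class.
have double_count : #|We|%:R *: \sum_(v in W) mono_class d (v * s)%g =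
    \sum_(w : 'S_n) (N w)%:R *: \pi_(Hquot n k) (term w).
  rewrite scaler_sumr.
  transitivity (\sum_(v in W)
      \sum_(w | (w * (v * s)^-1)%g \in We) \pi_(Hquot n k) (term w)).
    apply: eq_bigr => v Wv; rewrite (reindex_inj (mulIg (v * s)%g)) /=.
    rewrite (eq_bigl (mem We)) => [|u]; last by rewrite mulgK.
    by rewrite (eq_bigr _ (fun u Wu => termE u v Wu Wv)) sumr_const scaler_nat.
  rewrite (exchange_big_dep xpredT) //=; apply: eq_bigr => w _.
  by rewrite sumr_const scaler_nat; congr (_ *+ _); apply: eq_card => v; rewrite [RHS]inE.
have N_const w : N w != 0%N -> N w = #|W :&: We|.
  rewrite -lt0n => /card_gt0P[v0]; rewrite inE => /andP[Wv0 We0].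
  rewrite -(card_rcoset _ v0); apply: eq_card => v; rewrite mem_rcoset [LHS]inE in_setI.
  rewrite (groupMr (G := W)) ?groupV //; congr (_ && _).
  rewrite -[RHS]groupV [in RHS]invMg invgK -[RHS](groupMl _ We0).
  by rewrite !invMg !mulgA mulgKV.
have N_lower w : N w = 0%N -> \pi_(Hquot n k) (term w) \in lower_span d.
  move=> N0; have <- : (fun p => b p + e p) = d by apply/funext.
  apply: product_lower => // t; rewrite brk_b => Wt; apply/negP => Wet.
  have /card0_eq/(_ (t * s^-1)%g) := N0.
  rewrite inE mulgKV Wt /= => /negP[].
  by rewrite -[_ \in _]/(_ \in We) -groupV invMg invgK.
have scaled : #|We|%:R *: \sum_(v in W) mono_class d (v * s)%g \in lower_span d.
  rewrite double_count (bigID (fun w => N w == 0%N)) /=.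
  rewrite big1 ?add0r => [|w /eqP->]; last by rewrite scale0r.
  rewrite (eq_bigr (fun w => #|W :&: We|%:R *: \pi_(Hquot n k) (term w))); last first.
    by move=> w /N_const ->.
  rewrite -scaler_sumr rpredZ //.
  have := sum_term; rewrite (bigID (fun w => N w == 0%N)) /= addrC => /eqP.
  rewrite addr_eq0 => /eqP->; rewrite -scaleN1r rpredZ //.
  by apply: rpred_sum => w /eqP; apply: N_lower.
have We_neq0 : #|We|%:R != 0 :> rat by rewrite pnatr_eq0 -lt0n cardG_gt0.
by rewrite -[X in X \in _](scalerK We_neq0) rpredZ.
Qed.

End Straightening.

(** * Straightening *)

Section Straightening2.
Variables n k : nat.
Hypothesis hk : (0 < k <= n)%N.
Implicit Types (d e f : 'I_n -> int) (s t u w : 'S_n) (m g : 'X_{1..n + n}).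
Local Notation Delta := (Delta n k).
Local Notation stair := (@staircase n k).
Local Notation wt := (@wt n k).
Local Notation weight := (@weight n k).
Local Notation wt_dominated := (@wt_dominated n k).
Local Notation J := (@Jideal n k).
Local Notation mono_class := (@mono_class n k).

(** A measure for inductions on dominance.  The constant [psum d k *+ 2 - psum d n] is
    the total degree: it makes each term nonnegative. *)
Definition psum_total d : int :=
  \sum_(j < n) (psum d j + (psum d k *+ 2 - psum d n)).

Lemma psum_total_ge0 d : weight d -> 0 <= psum_total d.
Proof.
move=> dW; apply: sumr_ge0 => j _.
have -> : psum d k *+ 2 - psum d n = \sum_p `|d p|.
  rewrite (psum_pos hk dW) psum_all -sumrMnl -sumrB; apply: eq_bigr => p _.
  by case: (d p) => a /=; lia.
rewrite [X in _ + X](bigID (fun p : 'I_n => (p < j)%N)) /= addrA -big_split /=.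
by rewrite addr_ge0 //; apply: sumr_ge0 => p _; lia.
Qed.

Lemma psum_total_lt d e : wt_dominated d e -> ~ d =1 e -> psum_total d < psum_total e.
Proof.
move=> [le_de eq_k eq_n] neq_de; rewrite lt_neqAle; apply/andP; split; last first.
  by apply: ler_sum => j _; rewrite eq_k eq_n lerD2r.
apply/eqP=> eq_tot; apply: neq_de; apply: psum_inj => j.
have eq_lt (i : 'I_n) : psum d i = psum e i.
  apply/eqP; rewrite eq_sym -subr_eq0; apply/eqP.
  have sum0 : \sum_(i < n) (psum e i - psum d i) = 0.
    have := eq_tot; rewrite /psum_total eq_k eq_n !big_split /= => /addIr eq_s.
    by rewrite sumrN eq_s subrr.
  by apply: (psumr_eq0P _ sum0) => // l _; rewrite subr_ge0.
have [lt_jn|] := ltnP j n; first exact: eq_lt (Ordinal lt_jn).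
rewrite leq_eqVlt => /orP[/eqP<- //|lt_nj].
have all_j f : psum f j = psum f n.
  by apply: eq_bigl => p; rewrite ltn_ord (ltn_trans (ltn_ord p)).
by rewrite !all_j.
Qed.

Implicit Types v : Hquot n k.

Definition descent_span d : {pred Hquot n k} := lspan (fun v => exists2 s,
  wt_dominated (wt (Des s)) d & v = mono_class (wt (Des s)) s).
HB.instance Definition _ d := GRing.SubmodClosed.on (descent_span d).

Lemma descent_span_mono d e v :
  wt_dominated d e -> v \in descent_span d -> v \in descent_span e.
Proof.
move=> de; apply: (lspan_ind (U := descent_span e)) => {}v [s sd ->].
by apply: lspan_gen; exists s => //; apply: wt_dominated_trans sd de.
Qed.

(** By [young_triangular] it suffices to treat sums over cosets [W_(Des s) s].  Such a
    sum is a multiple of the descent monomial of [s] when [d] is its weight, and is of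
    lower weight otherwise. *)
Lemma straightening d t : weight d -> mono_class d t \in descent_span d.
Proof.
move=> dW; have [N lt_N] : exists N : nat, psum_total d < N%:Z.
  by exists `|psum_total d|.+1; have := psum_total_ge0 dW; lia.
elim: N d lt_N t dW => [|N IHN] d lt_N t dW.
  by have := psum_total_ge0 dW; lia.
apply: (young_triangular (U := descent_span d) (A := breaks d)) => [w s|s sDd].
  exact: mono_class_young (proj1 dW).
(* the induction hypothesis applies to the monomials of lower weight *)
have [eq_d|neq_d] := pselect (d =1 wt (Des s)); last first.
  apply: (lspan_ind (U := descent_span d) _ (young_sum_lower hk dW sDd neq_d)).
  move=> _ [d' [u [dW' le_d' neq_d' ->]]].
  apply: (descent_span_mono le_d'); apply: IHN => //.
  by have := psum_total_lt le_d' neq_d'; lia.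
apply: rpred_sum => w Ww; rewrite (@mono_class_young n k d w s (proj1 dW)); last first.
  by rewrite (_ : breaks d = Des s) // (funext eq_d) breaks_wt // => i; apply: Des_gt0.
rewrite (eq_mono_class _ _ eq_d); apply: lspan_gen; exists s => //.
by rewrite -(funext eq_d); apply: wt_dominated_refl.
Qed.

End Straightening2.

(** * Bipartitions as weights *)

Section Bipartitions.
Variables n k : nat.
Hypothesis hk : (0 < k <= n)%N.
Implicit Types (s : 'S_n) (A B : {set 'I_n}) (lam : seq nat * seq nat).
Local Notation wt := (@wt n k).
Local Notation wt_dominated := (@wt_dominated n k).

(** The exponents and the exponent bipartition of a descent monomial depend on the
    permutation only through its descent set. *)
Definition set_exp A (i : nat) : nat :=
  if (i < k)%N then #|[set j in A | (i <= j < k)%N]|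
  else #|[set j in A | (k <= j < i)%N]|.

Definition set_bipart A : seq nat * seq nat :=
  (rcons [seq set_exp A i | i <- iota 1 k.-1] 0%N,
   rcons (rev [seq set_exp A i | i <- iota k.+1 (n - k)]) 0%N).

Lemma exp_bipart_Des s : exp_bipart k s = set_bipart (Des s).
Proof. by []. Qed.

Lemma card_set_in A (P : pred 'I_n) :
  (#|[set j in A | P j]|)%:Z = \sum_(j in A) (P j)%:R.
Proof.
rewrite -sum1dep_card -natz natr_sum big_mkcondr /=.
by apply: eq_bigr => j _; case: (P j).
Qed.

Lemma wt_left A (p : 'I_n) : (p < k)%N -> wt A p = (#|[set j in A | (p.+1 <= j < k)%N]|)%:Z.
Proof.
by move=> lt_pk; rewrite card_set_in; apply: eq_bigr => j _; lia.
Qed.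

Lemma wt_right A (p : 'I_n) : (k <= p.+1)%N ->
  wt A p = - (#|[set j in A | (k <= j < p.+1)%N]|)%:Z.
Proof.
by move=> le_kp; rewrite card_set_in -sumrN; apply: eq_bigr => j _; lia.
Qed.

Lemma wt_set_exp A (p : 'I_n) :
  pospart (wt A p) = (if (p.+1 < k)%N then set_exp A p.+1 else 0%N) /\
  negpart (wt A p) = (if (k < p.+1)%N then set_exp A p.+1 else 0%N).
Proof.
rewrite /set_exp; have [lt_pk|lt_kp|eq_pk] := ltngtP p.+1 k.
- by rewrite wt_left ?(ltnW lt_pk).
- by rewrite wt_right ?(ltnW lt_kp) //; case: #|_|.
by rewrite (proj2 (wt_weight k A)).
Qed.

Lemma a_monE s : a_mon k s = 'X_[mon_along (wt (Des s)) s].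
Proof.
rewrite /mon_along monomial_prod (reindex_inj (@perm_inj _ s)) /= big_split /=.
rewrite /a_mon; congr (_ * _); rewrite big_mkcond /=; apply: eq_bigr => p _;
  have [pE nE] := wt_set_exp (Des s) p.
  by rewrite permK pE; case: ifP.
by rewrite permK nE; case: ifP.
Qed.

Lemma nth_set_bipart1 A (p : 'I_n) : (p < k)%N ->
  (nth 0%N (set_bipart A).1 p)%:Z = wt A p.
Proof.
move=> lt_pk; rewrite /= nth_rcons size_map size_iota.
have [lt_p|le_p] := ltnP p k.-1.
  rewrite (nth_map 0%N) ?size_iota // nth_iota // add1n wt_left // /set_exp ifT //.
  by lia.
by rewrite if_same (proj2 (wt_weight k A)) //; lia.
Qed.

Lemma nth_set_bipart2 A (p : 'I_n) : (k <= p.+1)%N ->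
  (nth 0%N (set_bipart A).2 (n.-1 - p))%:Z = - wt A p.
Proof.
move=> le_kp; have lt_pn := ltn_ord p.
rewrite /= nth_rcons size_rev size_map size_iota.
have [lt_p|le_p] := ltnP (n.-1 - p) (n - k).
  rewrite nth_rev size_map size_iota // (nth_map 0%N) ?size_iota; last by lia.
  rewrite nth_iota; last by lia.
  rewrite wt_right // opprK /set_exp.
  have -> : (k.+1 + (n - k - (n.-1 - p).+1) = p.+1)%N by lia.
  by rewrite ltnNge le_kp.
by rewrite if_same (proj2 (wt_weight k A)) ?oppr0 //; lia.
Qed.

Lemma size_set_bipart A :
  size (set_bipart A).1 = k /\ size (set_bipart A).2 = (n - k).+1.
Proof. by rewrite /= !size_rcons size_rev !size_map !size_iota; lia. Qed.

Lemma sumn_takeS (s : seq nat) i : sumn (take i.+1 s) = (sumn (take i s) + nth 0%N s i)%N.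
Proof.
have [lt_is|le_si] := ltnP i (size s); first by rewrite (take_nth 0%N lt_is) sumn_rcons.
by rewrite nth_default // !take_oversize // ?addn0 // leqW.
Qed.

Lemma sumn_take1 A i : (i <= k)%N -> (sumn (take i (set_bipart A).1))%:Z = psum (wt A) i.
Proof.
elim: i => [|i IHi] lt_ik; first by rewrite take0 /psum big_pred0.
have lt_in : (i < n)%N by lia.
rewrite sumn_takeS PoszD IHi 1?ltnW //.
by rewrite (nth_set_bipart1 A (p := Ordinal lt_in)) // -(psumS _ (Ordinal lt_in)).
Qed.

Lemma sumn_take2 A i : (i <= (n - k).+1)%N ->
  (sumn (take i (set_bipart A).2))%:Z = psum (wt A) (n - i) - psum (wt A) n.
Proof.
elim: i => [|i IHi] lt_ik; first by rewrite take0 subn0 subrr.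
have lt_in : (n - i.+1 < n)%N by lia.
have := @psumS _ (wt A) (Ordinal lt_in).
have le_k : (k <= (Ordinal lt_in).+1)%N by rewrite /=; lia.
have := nth_set_bipart2 A le_k.
have -> : (n.-1 - Ordinal lt_in = i)%N by rewrite /=; lia.
have -> : (Ordinal lt_in).+1 = (n - i)%N by rewrite /=; lia.
rewrite sumn_takeS PoszD IHi 1?ltnW // => -> -> /=.
by rewrite addrAC addrK.
Qed.

Lemma psum_pred A : psum (wt A) k.-1 = psum (wt A) k.
Proof.
have lt_kn : (k.-1 < n)%N by lia.
have := @psumS _ (wt A) (Ordinal lt_kn).
by rewrite (proj2 (wt_weight k A)) /= ?prednK ?addr0 //; lia.
Qed.

Lemma bidominated_wt A B :
  bidominated (set_bipart A) (set_bipart B) <-> wt_dominated (wt A) (wt B).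
Proof.
have [sA1 sA2] := size_set_bipart A; have [sB1 sB2] := size_set_bipart B.
have sum1 C : (sumn (set_bipart C).1)%:Z = psum (wt C) k.
  have [s1 _] := size_set_bipart C.
  by rewrite -{1}(@take_oversize _ k (set_bipart C).1) ?sumn_take1 ?s1.
have sum2 C : (sumn (set_bipart C).2)%:Z = psum (wt C) k - psum (wt C) n.
  have [_ s2] := size_set_bipart C.
  rewrite -{1}(@take_oversize _ (n - k).+1 (set_bipart C).2) ?sumn_take2 ?s2 //.
  by rewrite -(psum_pred C); congr (psum _ _ - _); lia.
rewrite /bidominated /dominated; split=> [[[eq1 le1] [eq2 le2]]|[le_AB eq_k eq_n]].
  have eq_k : psum (wt A) k = psum (wt B) k by rewrite -!sum1 eq1.
  have eq_n : psum (wt A) n = psum (wt B) n.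
    by have := sum2 A; have := sum2 B; rewrite eq2 eq_k; lia.
  split=> // j; have [le_jk|lt_kj] := leqP j k.
    by rewrite -!sumn_take1 // lez_nat.
  have [le_jn|lt_nj] := leqP j n.
    have := le2 (n - j)%N; rewrite -lez_nat !sumn_take2; [|lia..].
    by rewrite subKn // eq_n lerD2r.
  have psum_j C : psum (wt C) j = psum (wt C) n.
    by apply: eq_bigl => p; rewrite ltn_ord (ltn_trans (ltn_ord p)).
  by rewrite !psum_j eq_n.
split; split.
- by apply/eqP; rewrite -eqz_nat !sum1 eq_k.
- move=> i; rewrite -lez_nat; have [le_ik|lt_ki] := leqP i k; first by rewrite !sumn_take1.
  by rewrite !take_oversize ?sum1 ?eq_k // ?sA1 ?sB1 ltnW.
- by apply/eqP; rewrite -eqz_nat !sum2 eq_k eq_n.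
move=> i; rewrite -lez_nat; have [le_ik|lt_ki] := leqP i (n - k).+1.
  by rewrite !sumn_take2 // eq_n lerD2r.
by rewrite !take_oversize ?sum2 ?eq_k ?eq_n // ?sA2 ?sB2 ltnW.
Qed.

Lemma set_bipart_wt A B : set_bipart A = set_bipart B -> wt A =1 wt B.
Proof.
move=> eq_AB p; have [lt_pk|le_kp] := ltnP p k.
  by rewrite -!nth_set_bipart1 // eq_AB.
by apply: oppr_inj; rewrite -!nth_set_bipart2 1?leqW // eq_AB.
Qed.

Lemma A_of_gt0 lam i : i \in A_of n k lam -> (0 < i)%N.
Proof. by rewrite !inE; lia. Qed.

Lemma bipartition_A_of lam : is_bipartition n k lam -> lam = set_bipart (A_of n k lam).
Proof.
case: lam => mu nu /andP[/and4P[/eqP/= szm srtm /eqP m0 /allP stm]].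
move=> /and4P[/eqP/= szn srtn /eqP n0 /allP stn].
set A := A_of n k (mu, nu).
have mono (l : seq nat) i : sorted geq l -> (nth 0%N l i.+1 <= nth 0%N l i)%N.
  move=> srt; have [lt_i|] := ltnP i.+1 (size l); last by move/(nth_default 0%N) ->.
  by have /(sortedP 0%N)/(_ i lt_i) := srt.
have muE (p : 'I_n) : (p < k)%N -> (nth 0%N mu p)%:Z = wt A p.
  move=> lt_pk; have [m def_p] : exists m, (p + m = k.-1)%N by exists (k.-1 - p)%N; lia.
  elim: m p lt_pk def_p => [|m IHm] p lt_pk def_p.
    rewrite (proj2 (wt_weight k A)); last by lia.
    by move: def_p; rewrite addn0 => ->; rewrite m0.
  have lt_in : (p.+1 < n)%N by lia.
  have def_i : p.+1 = Ordinal lt_in by [].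
  rewrite (wt_step k A def_i) -IHm /=; [|lia|lia].
  have -> : (Ordinal lt_in \in A) = (nth 0%N mu p - nth 0%N mu p.+1 == 1)%N.
    by rewrite !inE /=; lia.
  have := mono mu p srtm; have := stm p; rewrite mem_iota; lia.
have nuE (p : 'I_n) : (k <= p.+1)%N -> (nth 0%N nu (n.-1 - p))%:Z = - wt A p.
  move=> le_kp; have [m def_p] : exists m, (p = k.-1 + m :> nat)%N by exists (p - k.-1)%N; lia.
  elim: m p le_kp def_p => [|m IHm] p le_kp def_p.
    rewrite (proj2 (wt_weight k A)) ?oppr0; last by lia.
    have -> : (n.-1 - p = n - k)%N by lia.
    by rewrite n0.
  have lt_pn := ltn_ord p; have lt_jn : (p.-1 < n)%N by lia.
  have def_i : (Ordinal lt_jn).+1 = p by rewrite /=; lia.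
  have := IHm (Ordinal lt_jn); rewrite (wt_step k A def_i) /= => IH.
  have iA : (p \in A) = (nth 0%N nu (n.-1 - p) - nth 0%N nu (n.-1 - p).+1 == 1)%N.
    rewrite !inE /=; have -> : ((n - p).-1 = n.-1 - p)%N by lia.
    have -> : (n - p = (n.-1 - p).+1)%N by lia.
    lia.
  have : (nth 0%N nu (n.-1 - p).+1)%:Z = - (wt A p + (p \in A)%:R).
    by rewrite -IH; [congr (_%:Z); congr nth; lia|lia|lia].
  rewrite iA; have := mono nu (n.-1 - p)%N srtn; have := stn (n.-1 - p)%N.
  rewrite mem_iota; lia.
have [s1 s2] := size_set_bipart A; congr (_, _); apply: (@eq_from_nth _ 0%N).
- by rewrite s1.
- move=> i; rewrite szm => lt_ik; have lt_in : (i < n)%N by lia.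
  apply/eqP; rewrite -eqz_nat (nth_set_bipart1 A (p := Ordinal lt_in)) //.
  by rewrite -(muE (Ordinal lt_in)).
- by rewrite s2.
move=> i; rewrite szn => lt_ik; have lt_in : (n.-1 - i < n)%N by lia.
have le_k : (k <= (Ordinal lt_in).+1)%N by rewrite /=; lia.
have iE : i = (n.-1 - Ordinal lt_in)%N by rewrite /=; lia.
by apply/eqP; rewrite -eqz_nat {1 2}iE nuE // nth_set_bipart2.
Qed.

End Bipartitions.

(** * The regular representation in the coset-sum basis *)

Section DescentMatrix.
Variable n : nat.
Implicit Types (p r s t u w : 'S_n) (A B : {set 'I_n}).

(** The matrix, in the basis of permutations, of the indicators of the cosets
    [W_(Des p) p]. *)
Definition block_coef p t : rat := ((t * p^-1)%g \in young_set (Des p))%:R.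

Lemma sum_block_coef (V : lmodType rat) p (F : 'S_n -> V) :
  \sum_t block_coef p t *: F t = \sum_(w in young_set (Des p)) F (w * p)%g.
Proof.
rewrite (reindex_inj (mulIg p)) [RHS]big_mkcond; apply: eq_bigr => w _.
by rewrite /block_coef mulgK; case: (_ \in _); rewrite ?scale1r ?scale0r.
Qed.

Lemma sum_block_coefM p (F : 'S_n -> rat) :
  \sum_t block_coef p t * F t = \sum_(w in young_set (Des p)) F (w * p)%g.
Proof. exact: (sum_block_coef p (F : 'S_n -> rat^o)). Qed.

Lemma young_setT : young_set [set: 'I_n] = [set 1%g].
Proof.
apply/setP=> w; rewrite in_set1; apply/idP/eqP => [/youngP wT|->].
  apply/permP=> p; rewrite perm1; apply/val_inj.
  have := wT p p (in_setT p); have := wT p (w p) (in_setT _).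
  by rewrite !ltnn; case: ltngtP.
exact: (@group1 _ (young_group _)).
Qed.

(** Invertibility is [young_triangular] for the trivial Young subgroup: the coset
    indicators span all functions. *)
Lemma block_matrix_inverse : exists Vi : 'S_n -> 'S_n -> rat,
  (forall t t', \sum_p Vi t p * block_coef p t' = (t == t')%:R) /\
  (forall p p', \sum_t block_coef p t * Vi t p' = (p == p')%:R).
Proof.
pose N := #|{: 'S_n}|.
pose M : 'M[rat]_N := \matrix_(i, j) block_coef (enum_val i) (enum_val j).
pose U := lspan (fun v : 'rV[rat]_N => exists i, v = row i M).
have deltaU t : delta_mx 0 (enum_rank t) \in U.
  apply: (young_triangular (U := U) (A := setT)
    (Y := fun t => delta_mx 0 (enum_rank t))) => [w s|s _].
    by rewrite young_setT in_set1 => /eqP->; rewrite mul1g.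
  apply: lspan_gen; exists (enum_rank s); apply/rowP => j.
  rewrite summxE !mxE enum_rankK /block_coef; set t0 := enum_val j.
  have eq_j w : (j == enum_rank (w * s)%g) = (w == (t0 * s^-1)%g).
    by rewrite -(inj_eq enum_val_inj) enum_rankK eq_sym -(inj_eq (mulIg s^-1%g)) mulgK.
  under eq_bigr => w _ do rewrite !mxE /= eq_j.
  rewrite big_mkcond (bigD1 (t0 * s^-1)%g) //= eqxx big1 ?addr0 => [|w /negbTE->].
    by case: (_ \in _).
  by rewrite if_same.
have M_unit : M \in unitmx.
  rewrite -row_full_unit -sub1mx; apply/row_subP => i; rewrite row1.
  have := deltaU (enum_val i); rewrite enum_valK => /lspanP[m [c [w [wM ->]]]].
  apply: summx_sub => j _; apply: scalemx_sub; have [l ->] := wM j; exact: row_sub.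
exists (fun t p => invmx M (enum_rank t) (enum_rank p)); split=> [t t'|p p'].
  have /matrixP/(_ (enum_rank t) (enum_rank t')) := mulVmx M_unit.
  rewrite !mxE (inj_eq enum_rank_inj) => <-.
  rewrite (reindex _ (onW_bij _ (@enum_rank_bij _))) /=.
  by apply: eq_bigr => p _; rewrite mxE !enum_rankK.
have /matrixP/(_ (enum_rank p) (enum_rank p')) := mulmxV M_unit.
rewrite !mxE (inj_eq enum_rank_inj) => <-.
rewrite (reindex _ (onW_bij _ (@enum_rank_bij _))) /=.
by apply: eq_bigr => t _; rewrite mxE !enum_rankK.
Qed.

(** Toggling an element of [A] outside [D] is a sign-reversing involution. *)
Lemma sum_sign_interval (T : finType) (A D : {set T}) :
  \sum_(B : {set T} | (D \subset B) && (B \subset A)) (-1) ^+ #|A :\: B| =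
    (D == A)%:R :> rat.
Proof.
have [->|neq_DA] := eqVneq D A.
  rewrite (big_pred1 A) => [|B]; first by rewrite setDv cards0.
  by rewrite andbC -eqEsubset.
case: (boolP (D \subset A)) => [sDA|not_DA]; last first.
  rewrite big_pred0 // => B; apply: contraNF not_DA => /andP[]; exact: subset_trans.
have /properP[_ [x xA xD]] : D \proper A by rewrite properEneq neq_DA.
pose toggle (B : {set T}) := if x \in B then B :\ x else x |: B.
have toggleK : involutive toggle.
  move=> B; rewrite /toggle; case xB: (x \in B); first by rewrite setD11 setD1K.
  by rewrite setU11 setU1K ?xB.
have toggle_interval (B : {set T}) : (D \subset toggle B) && (toggle B \subset A) =
    (D \subset B) && (B \subset A).
  rewrite /toggle; case xB: (x \in B).
    by rewrite subsetD1 xD andbT subDset (setUidPr _) // sub1set.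
  rewrite subUset sub1set xA /=; congr (_ && _).
  by rewrite -{2}(setU1K (negbT xB)) subsetD1 xD andbT.
have toggle_card (B : {set T}) : (-1) ^+ #|A :\: toggle B| = - (-1) ^+ #|A :\: B| :> rat.
  rewrite /toggle; case xB: (x \in B).
    rewrite setDDr (setIidPr _) ?sub1set // setUC cardsU1 inE xB /=.
    by rewrite add1n exprS mulN1r.
  by rewrite setUC -setDDl [in RHS](cardsD1 x) inE xB xA /= add1n exprS mulN1r opprK.
apply/eqP; rewrite -eqNr -sumrN [X in _ == X](reindex_inj (inv_inj toggleK)) /=.
by apply/eqP/eq_big => [B|B _]; rewrite ?toggle_interval ?toggle_card.
Qed.

End DescentMatrix.

Section DescentTrace.
Variable n : nat.
Implicit Types (p r s t u w : 'S_n) (A B : {set 'I_n}).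
Variable Vi : 'S_n -> 'S_n -> rat.
Hypothesis ViV : forall t t', \sum_p Vi t p * block_coef p t' = (t == t')%:R.
Hypothesis VVi : forall p p', \sum_t block_coef p t * Vi t p' = (p == p')%:R.

(** The matrix of right multiplication by [s] in the basis of coset indicators. *)
Definition descent_coef s p r : rat := \sum_t block_coef p t * Vi (t * s)%g r.

Lemma descent_coefE s p t :
  \sum_r descent_coef s p r * block_coef r t = block_coef p (t * s^-1)%g.
Proof.
under eq_bigr => r _ do rewrite /descent_coef mulr_suml.
rewrite exchange_big /= (bigD1 (t * s^-1)%g) //= [X in _ + X]big1 => [|u neq_u].
  under eq_bigr => r _ do rewrite -mulrA.
  by rewrite -mulr_sumr ViV mulgKV eqxx mulr1 addr0.
under eq_bigr => r _ do rewrite -mulrA.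
rewrite -mulr_sumr ViV; case: eqP => [def_t|]; last by rewrite mulr0.
by rewrite -def_t mulgK eqxx in neq_u.
Qed.

(** The indicator of a coset of [W_A] is a combination of the basis vectors [r] with
    [Des r] inside [A], by [young_triangular] once more. *)
Lemma inverse_young_sum A t r : ~~ (Des r \subset A) ->
  \sum_(w in young_set A) Vi (w * t)%g r = 0.
Proof.
move=> not_rA; pose U := lspan (fun _ : rat^o => False).
suff : (\sum_(w in young_set A) Vi (w * t)%g r : rat^o) \in U.
  by case/lspanP=> m [c [w [w0 ->]]]; rewrite big1 // => i; case: (w0 i).
apply: (young_triangular (U := U) (A := A)
  (Y := fun t => \sum_(w in young_set A) Vi (w * t)%g r : rat^o)) => {t}[u t Wu|p pA].
  under eq_bigr => w _ do rewrite mulgA.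
  by rewrite (sum_young_shift (fun w => Vi (w * t)%g r : rat^o)).
rewrite exchange_big big1 ?rpred0 //= => w Ww.
have Www : w \in young_set (Des p) by apply: (subsetP (young_subset pA)).
transitivity (\sum_(v in young_set (Des p)) Vi (v * p)%g r).
  rewrite [RHS](reindex_inj (mulgI w)) /=; apply: eq_big => v.
    by rewrite (@groupMl _ (young_group _)).
  by rewrite mulgA.
rewrite -(sum_block_coefM p (fun t => Vi t r)) VVi; case: eqP => // eq_pr.
by rewrite -eq_pr pA in not_rA.
Qed.

(** Right multiplication by [s] maps the coset [W_(Des p) p] to another coset of the
    same subgroup. *)
Lemma descent_coef_eq0 s p r : ~~ (Des r \subset Des p) -> descent_coef s p r = 0.
Proof.
move=> not_rp; rewrite /descent_coef (sum_block_coefM _ (fun t => Vi (t * s)%g r)).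
under eq_bigr => w _ do rewrite -mulgA.
exact: inverse_young_sum.
Qed.

(** Both sides are the trace of [s] on the [W_A]-invariants of the regular
    representation.  The left side computes it in the basis of coset indicators.
    Averaging over [W_A] does not change these diagonal coefficients and kills those
    of the other basis vectors, so the sum may be taken over the whole basis, hence
    equally well in the basis of permutations, which gives the right side. *)
Lemma descent_trace A s :
  \sum_(p | Des p \subset A) descent_coef s p p =
  #|young_set A|%:R^-1 * \sum_t ((t * s * t^-1)%g \in young_set A)%:R.
Proof.
have W_neq0 : #|young_set A|%:R != 0 :> rat.
  by rewrite pnatr_eq0 -lt0n; apply: (@cardG_gt0 _ (young_group A)).
apply: (canRL (mulKf W_neq0)).
pose avg p := \sum_t block_coef p t * \sum_(w in young_set A) Vi (w * (t * s))%g p.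
transitivity (\sum_p avg p).
  rewrite mulr_sumr [RHS](bigID (fun p => Des p \subset A)) /=.
  rewrite [X in _ = _ + X]big1 ?addr0 => [|p not_pA]; last first.
    by rewrite /avg big1 // => t _; rewrite inverse_young_sum ?mulr0.
  apply: eq_bigr => p pA.
  rewrite /avg (sum_block_coefM _ (fun t => \sum_(w in _) Vi (w * (t * s))%g p)).
  rewrite exchange_big /= mulr_natl -sumr_const; apply: eq_bigr => w Ww.
  have Www : w \in young_set (Des p) by apply: (subsetP (young_subset pA)).
  rewrite /descent_coef (sum_block_coefM _ (fun t => Vi (t * s)%g p)).
  rewrite [LHS](reindex_inj (mulgI w)) /=; apply: eq_big => v.
    by rewrite (@groupMl _ (young_group _)).
  by rewrite !mulgA.
rewrite /avg exchange_big; apply: eq_bigr => t _ /=.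
under eq_bigr => p _ do rewrite mulrC mulr_suml.
rewrite exchange_big /=; under eq_bigr => w _ do rewrite ViV.
rewrite -[_ \in _](@groupV _ (young_group A)) !invMg invgK mulgA.
have eq_t w : ((w * (t * s))%g == t) = (w == (t * s^-1 * t^-1)%g).
  by rewrite -(inj_eq (mulIg (t * s)^-1%g)) mulgK invMg mulgA.
under eq_bigr => w _ do rewrite eq_t.
rewrite big_mkcond (bigD1 (t * s^-1 * t^-1)%g) //= eqxx big1 ?addr0 => [|w /negbTE->].
  by case: (_ \in _).
by rewrite if_same.
Qed.

Lemma solomon_charE A s :
  solomon_char A s = ratr (\sum_(p | Des p == A) descent_coef s p p).
Proof.
have IndE B : 'Ind[[set: 'S_n], young_set B] 1 s =
    ratr (\sum_(p | Des p \subset B) descent_coef s p p).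
  rewrite (@cfIndE _ _ (young_group B)) ?subsetT // descent_trace rmorphM fmorphV !rmorph_nat.
  congr (_ * _); rewrite rmorph_sum (reindex_inj invg_inj) /=.
  apply: eq_big => t; first by rewrite inE.
  by rewrite (@cfun1E _ (young_group B)) conjgE invgK mulgA rmorph_nat.
rewrite /solomon_char sum_cfunE.
under eq_bigr => B _ do rewrite cfunE IndE -[(-1) ^+ _](rmorph_sign ratr) -rmorphM.
rewrite -rmorph_sum; congr (ratr _).
under eq_bigr => B _ do rewrite mulr_sumr.
rewrite (exchange_big_dep xpredT) //= [RHS]big_mkcond; apply: eq_bigr => p _.
rewrite -mulr_suml; under eq_bigl => B do rewrite andbC.
by rewrite sum_sign_interval; case: eqP; rewrite ?mul1r ?mul0r.
Qed.

End DescentTrace.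

(** * Pairing descent monomials with Delta *)

Section Pairing.
Variables n k : nat.
Hypothesis hk : (0 < k <= n)%N.
Implicit Types (s t u w p : 'S_n) (A B : {set 'I_n}).
Local Notation Delta := (Delta n k).
Local Notation stair := (@staircase n k).
Local Notation wt := (@wt n k).
Local Notation wt_dominated := (@wt_dominated n k).
Local Notation weight := (@weight n k).

(** The complementary exponents: multiplying the descent monomial of [p] by this
    weight along [p] yields a monomial of Delta. *)
Definition costair A (q : 'I_n) : int := stair q - wt A q.

Lemma stair_weight : weight stair.
Proof.
split=> [p q le_pq|p def_k]; rewrite /staircase; lia.
Qed.

Lemma mem_breaks_stair (i : 'I_n) : (0 < i)%N -> i \in breaks stair.
Proof.
move=> i0; have lt_i : (i.-1 < n)%N by have := ltn_ord i; lia.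
have def_i : (Ordinal lt_i).+1 = i by rewrite /=; lia.
by rewrite (mem_breaks _ def_i) (stair_step k def_i); lia.
Qed.

Lemma costair_weight A : (forall i, i \in A -> (0 < i)%N) -> weight (costair A).
Proof.
move=> A0; have sA : A \subset breaks stair.
  by apply/subsetP => i /A0; apply: mem_breaks_stair.
exact: weightB stair_weight sA.
Qed.

Lemma mem_breaks_costair A (i : 'I_n) : (0 < i)%N -> i \notin A -> i \in breaks (costair A).
Proof.
move=> i0 iA; have lt_i : (i.-1 < n)%N by have := ltn_ord i; lia.
have def_i : (Ordinal lt_i).+1 = i by rewrite /=; lia.
rewrite (mem_breaks _ def_i) /costair (wt_step k A def_i) (negbTE iA) (stair_step k def_i).
by lia.
Qed.

(** If the product is a monomial of Delta, placed along [t], prefix sums give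
    [wt A <= wt B] in dominance order; with the opposite inequality everything is
    tight, and [t] sorts both factors. *)
Lemma Delta_costair A B p s :
    (forall i, i \in A -> (0 < i)%N) -> (forall i, i \in B -> (0 < i)%N) ->
    wt_dominated (wt B) (wt A) ->
    Delta@_(mon_along (costair A) p + mon_along (wt B) s) != 0 ->
  wt B =1 wt A /\ exists t,
    (t * p^-1)%g \in young_set (breaks (costair A)) /\ (t * s^-1)%g \in young_set B.
Proof.
move=> A0 B0 [le_BA _ _] /(Delta_support hk)[t eq_m].
have [dA dB] : noninc (costair A) /\ noninc (wt B).
  by split; [apply: (proj1 (costair_weight A0)) | apply: (proj1 (wt_weight k B))].
have eq_t i : costair A (p^-1%g i) + wt B (s^-1%g i) = stair (t^-1%g i).
  move: i; apply: mon_inj; rewrite -(@mon_dvd2 _ _ _ 0%MM (fun i => stair (t^-1%g i))) //.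
  by rewrite addm0.
have psum_t j : psum stair j =
    psum (costair A \o (t * p^-1)%g) j + psum (wt B \o (t * s^-1)%g) j.
  rewrite -psumD; apply: psum_ext => q.
  by rewrite /= !permM eq_t permK.
have psum_stair j : psum stair j = psum (costair A) j + psum (wt A) j.
  by rewrite -psumD; apply: psum_ext => q; rewrite /costair subrK.
have le_c j : psum (costair A \o (t * p^-1)%g) j <= psum (costair A) j by apply: psum_perm_le.
have le_b j : psum (wt B \o (t * s^-1)%g) j <= psum (wt B) j by apply: psum_perm_le.
split.
  apply: psum_inj => j; have := psum_t j; have := psum_stair j.
  by have := le_c j; have := le_b j; have := le_BA j; lia.
exists t; have [|cp bs] := @psum_split_eq n (costair A) (wt B) (t * p^-1)%g (t * s^-1)%g dA dB.
  move=> j; have := psum_t j; have := psum_stair j.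
  by have := le_c j; have := le_b j; have := le_BA j; lia.
split; first exact: breaks_young.
by rewrite -(breaks_wt k B0); apply: breaks_young.
Qed.

(** Through the permutation [t] of [Delta_costair]: [s] is least in its coset of
    [W_A], which contains [t], and [p] is largest in its coset of the complementary
    Young subgroup, which contains [t] as well. *)
Lemma Delta_costair_lex A p s : Des p = A -> Des s = A ->
  Delta@_(mon_along (costair A) p + mon_along (wt A) s) != 0 -> s = p \/ lexlt s p.
Proof.
move=> DpA DsA nz; have A0 i : i \in A -> (0 < i)%N by rewrite -DpA; apply: Des_gt0.
have [_ [t [Wp Ws]]] := Delta_costair A0 A0 (wt_dominated_refl _ _) nz.
have s_t : s = t \/ lexlt s t.
  have [/eqP|neq1] := eqVneq (t * s^-1)%g 1%g.
    by rewrite -eq_mulgV1 => /eqP ->; left.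
  by right; rewrite -(mulgKV s t); apply: (lexlt_young (B := A)); rewrite ?DsA.
have t_p : t = p \/ lexlt t p.
  have [/eqP|neq1] := eqVneq (t * p^-1)%g 1%g.
    by rewrite -eq_mulgV1 => /eqP ->; left.
  right; rewrite -[X in lexlt X _](mulgKV p t).
  apply: (lexlt_young_Des (A := A) _ _ Wp neq1); rewrite ?DpA //.
  exact: mem_breaks_costair.
case: s_t t_p => [->|lt_st] [<-|lt_tp]; auto.
by right; apply: lexlt_trans lt_st lt_tp.
Qed.

Lemma Delta_costair_diag A p : (forall i, i \in A -> (0 < i)%N) ->
  Delta@_(mon_along (costair A) p + mon_along (wt A) p) != 0.
Proof.
move=> A0; rewrite (mon_alongD hk _ (costair_weight A0) (wt_weight k A)).
have -> : mon_along (fun q => costair A q + wt A q) p = mon_along stair p.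
  by apply: eq_mon => i; rewrite /costair subrK.
exact: Delta_stair.
Qed.

End Pairing.

(** * The descent module *)

Section DescentModule.
Variables (n k : nat) (lam : seq nat * seq nat).
Hypotheses (hk : (0 < k <= n)%N) (hlam : is_bipartition n k lam).
Implicit Types (s t u w p r : 'S_n).
Local Notation wt := (@wt n k).
Local Notation wt_dominated := (@wt_dominated n k).
Local Notation weight := (@weight n k).
Local Notation mono_class := (@mono_class n k).
Local Notation A := (A_of n k lam).
Local Notation Ile := (I_le n k lam).
Local Notation Ilt := (I_lt n k lam).

Lemma bidominated_lam s :
  bidominated (exp_bipart k s) lam <-> wt_dominated (wt (Des s)) (wt A).
Proof. by rewrite {1}(bipartition_A_of hk hlam) exp_bipart_Des bidominated_wt. Qed.

Lemma exp_bipart_lam s : exp_bipart k s = lam <-> Des s = A.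
Proof.
rewrite {1}(bipartition_A_of hk hlam) exp_bipart_Des; split=> [eq_sA|-> //].
have A0 i : i \in A -> (0 < i)%N by apply: (A_of_gt0 hk).
rewrite -(breaks_wt k A0) -(breaks_wt k (@Des_gt0 n s)).
by rewrite (funext (set_bipart_wt hk eq_sA)).
Qed.

Lemma wt_eq_A s : wt (Des s) =1 wt A -> Des s = A.
Proof.
move=> eq_w; have A0 i : i \in A -> (0 < i)%N by apply: (A_of_gt0 hk).
by rewrite -(breaks_wt k A0) -(breaks_wt k (@Des_gt0 n s)) (funext eq_w).
Qed.

Lemma I_le_gen d t : weight d -> wt_dominated d (wt A) -> mono_class d t \in Ile.
Proof.
move=> dW le_d; apply: (lspan_ind (U := Ile) _ (straightening hk t dW)).
move=> _ [s le_s ->]; apply: lspan_gen; exists s; last by rewrite (a_monE hk).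
by apply/bidominated_lam; apply: wt_dominated_trans le_s le_d.
Qed.

(** Straightening yields descent monomials dominated by [d], and none of them can have
    weight [wt A], for dominance is antisymmetric. *)
Lemma I_lt_gen d t :
  weight d -> wt_dominated d (wt A) -> ~ d =1 wt A -> mono_class d t \in Ilt.
Proof.
move=> dW le_d neq_d; apply: (lspan_ind (U := Ilt) _ (straightening hk t dW)).
move=> _ [s le_s ->]; apply: lspan_gen; exists s; last by rewrite (a_monE hk).
split; first by apply/bidominated_lam; apply: wt_dominated_trans le_s le_d.
move/exp_bipart_lam => def_s; apply: neq_d; apply: psum_inj => j; apply: le_anti.
by rewrite def_s in le_s; case: le_s => -> _ _; case: le_d => -> _ _.
Qed.

Lemma lspan_stable (S : Hquot n k -> Prop) (U : submodClosed (Hquot n k)) s :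
  (forall v, S v -> Hquot_act s v \in U) -> forall v, v \in lspan S -> Hquot_act s v \in U.
Proof.
move=> SU _ /lspanP[m [c [w [Sw ->]]]]; rewrite linear_sum rpred_sum // => i _.
by rewrite linearZ rpredZ ?SU.
Qed.

Lemma Ile_stable : Sn_stable Ile.
Proof.
move=> s; apply: (lspan_stable (U := Ile)) => _ [t /bidominated_lam le_t ->].
by rewrite (a_monE hk) mono_class_act; apply: I_le_gen le_t; apply: wt_weight.
Qed.

Lemma Ilt_stable : Sn_stable Ilt.
Proof.
move=> s; apply: (lspan_stable (U := Ilt)) => _ [t [/bidominated_lam le_t neq_t] ->].
rewrite (a_monE hk) mono_class_act; apply: I_lt_gen le_t _; first exact: wt_weight.
by move/wt_eq_A/exp_bipart_lam.
Qed.

Lemma lower_I_lt v : v \in lower_span (wt A) -> v \in Ilt.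
Proof.
by apply: (lspan_ind (U := Ilt)) => _ [d [t [dW le_d neq_d ->]]]; apply: I_lt_gen.
Qed.

(** Write the descent monomial as a multiple of a sum of monomials of weight [wt A]
    over [W_A p], and expand the translate of this coset in the basis of coset
    indicators: the basis vectors with a smaller descent set contribute terms of lower
    weight. *)
Lemma act_descent_class (Vi : 'S_n -> 'S_n -> rat) s p :
    (forall t t', \sum_r Vi t r * block_coef r t' = (t == t')%:R) ->
    (forall r r', \sum_t block_coef r t * Vi t r' = (r == r')%:R) ->
    Des p = A ->
  mono_class (wt A) (p * s)%g -
      \sum_(r | Des r == A) descent_coef Vi s p r *: mono_class (wt A) r
    \in Ilt.
Proof.
move=> ViV VVi DpA; pose W := young_group A; pose Y := mono_class (wt A).
have A0 i : i \in A -> (0 < i)%N by apply: (A_of_gt0 hk).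
have YW w t : w \in W -> Y (w * t)%g = Y t.
  move=> Ww; apply: mono_class_young; first exact: (proj1 (wt_weight k A)).
  by rewrite breaks_wt.
have sumYW t : \sum_(w in W) Y (w * t)%g = #|W|%:R *: Y t.
  by rewrite (eq_bigr (fun=> Y t)) => [|w /YW//]; rewrite sumr_const scaler_nat.
have W_neq0 : #|W|%:R != 0 :> rat by rewrite pnatr_eq0 -lt0n cardG_gt0.
have expand : #|W|%:R *: Y (p * s)%g =
    \sum_r descent_coef Vi s p r *: \sum_(w in young_set (Des r)) Y (w * r)%g.
  rewrite -sumYW; transitivity (\sum_t block_coef p (t * s^-1)%g *: Y t).
    rewrite [RHS](reindex_inj (mulIg s)) /=.
    under [RHS]eq_bigr => t _ do rewrite mulgK.
    rewrite (sum_block_coef p (fun t => Y (t * s)%g)) DpA.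
    by apply: eq_bigr => w _; rewrite mulgA.
  under eq_bigr => t _ do rewrite -(descent_coefE ViV) scaler_suml.
  rewrite exchange_big /=; apply: eq_bigr => r _.
  by rewrite -sum_block_coef scaler_sumr; apply: eq_bigr => t _; rewrite scalerA.
rewrite -[X in X \in _](scalerK W_neq0) rpredZ // scalerBr expand.
rewrite (bigID (fun r => Des r == A)) /= scaler_sumr addrAC -sumrB big1 ?add0r.
  apply: rpred_sum => r neq_rA.
  have [sub_rA|not_rA] := boolP (Des r \subset A); last first.
    by rewrite descent_coef_eq0 ?DpA // scale0r rpred0.
  apply: rpredZ; apply: lower_I_lt; apply: young_sum_lower => //.
  - exact: wt_weight.
  - by rewrite breaks_wt.
  - by move=> eq_w; case/eqP: neq_rA; apply: wt_eq_A => i; rewrite eq_w.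
by move=> r /eqP DrA; rewrite DrA sumYW !scalerA mulrC subrr.
Qed.

(** Pairing with the derivatives of Delta by the monomials [costair] kills the terms
    of strictly lower weight and is triangular on the others. *)
Lemma descent_classes_free (c : 'S_n -> rat) :
    \sum_(p | Des p == A) c p *: mono_class (wt A) p \in Ilt ->
  forall p, Des p = A -> c p = 0.
Proof.
move=> /lspanP[m [c' [v [v_lt eq_v]]]].
have A0 i : i \in A -> (0 < i)%N by apply: (A_of_gt0 hk).
have /choice[s sP] : forall i, exists s,
    [/\ wt_dominated (wt (Des s)) (wt A), Des s <> A & v i = mono_class (wt (Des s)) s].
  move=> i; have [s [/bidominated_lam le_s neq_s] ->] := v_lt i.
  by exists s; split; rewrite ?(a_monE hk) // => /exp_bipart_lam.
pose f1 : {mpoly rat[n + n]} := \sum_(p | Des p == A) c p *: 'X_[mon_along (wt A) p].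
pose f2 : {mpoly rat[n + n]} := \sum_i c' i *: 'X_[mon_along (wt (Des (s i))) (s i)].
have fJ : f1 - f2 \in @Jideal n k.
  rewrite -eq_lquot !raddf_sum; apply/eqP.
  transitivity (\sum_(p | Des p == A) c p *: mono_class (wt A) p).
    by apply: eq_bigr => p _; apply: pi_quot_scale.
  rewrite eq_v; apply: eq_bigr => i _.
  by have [_ _ ->] := sP i; apply/esym/pi_quot_scale.
have triangular q : \sum_(p | Des p == A) c p *
    (Delta n k)@_(mon_along (costair k A) q + mon_along (wt A) p) = 0.
  have := pair_Jideal (mon_along (costair k A) q) fJ.
  move/eqP; rewrite pair_withB subr_eq0 /f1 /f2 !(pair_Delta_sum hk).
  rewrite (inj_eq (mulfI (mfact_neq0 _))).
  rewrite [X in _ == X]big1 => [/eqP //|i _].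
  have [le_s neq_s _] := sP i; set D := _@_ _.
  have [->|nz] := eqVneq D 0; first by rewrite mulr0.
  case: neq_s; apply: wt_eq_A.
  by have [] := Delta_costair hk A0 (@Des_gt0 n (s i)) le_s nz.
move=> p; have [N] := ubnP (lexrank p); elim: N p => // N IHN p lt_N DpA.
have := triangular p; rewrite (bigD1 p) ?DpA //= big1 ?addr0 => [|r /andP[/eqP DrA neq_rp]].
  move/eqP; rewrite mulf_eq0 (negbTE (Delta_costair_diag hk p A0)) orbF.
  by move/eqP.
set D := _@_ _; have [->|nz] := eqVneq D 0; first by rewrite mulr0.
have [eq_rp|lt_rp] := Delta_costair_lex hk DpA DrA nz; first by rewrite eq_rp eqxx in neq_rp.
by rewrite IHN ?mul0r //; apply: leq_trans (lexrank_lt lt_rp) _; rewrite -ltnS.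
Qed.

End DescentModule.

(** * The isomorphism *)

Theorem theorem1p13 (n k : nat) (lam : seq nat * seq nat)
    (hk : (1 <= k <= n)%N) (hlam : is_bipartition n k lam) :
  exists (Ile : Sn_stable (I_le n k lam)) (Ilt : Sn_stable (I_lt n k lam))
         (d : nat) (rho : mx_representation rat [set: 'S_n] d),
    is_solomon_repr (A_of n k lam) rho /\
    exists f : {linear Rmod n k lam -> 'rV[rat]_d},
      bijective f /\
      forall (s : 'S_n) (v : Rmod n k lam), f (Rmod_act Ile s v) = f v *m rho s.
Proof.
have Ile := Ile_stable hk hlam; have Ilt := Ilt_stable hk hlam.
exists Ile, Ilt; set A := A_of n k lam.
have [Vi [ViV VVi]] := block_matrix_inverse n.
pose D := [set p : 'S_n | Des p == A].
pose d := #|D|; pose p (i : 'I_d) : 'S_n := enum_val i.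
have DesD i : Des (p i) = A by have := enum_valP i; rewrite inE => /eqP.
have AW := wt_weight k A.
pose y t : submod (I_le n k lam) :=
  Sub (mono_class k (wt k A) t) (I_le_gen hk hlam t AW (wt_dominated_refl k _)).
(* the inverse of the isomorphism: [g] expands coordinates in the classes of the
   descent monomials, and [G] lifts it before the quotient is taken *)
pose G (c : 'rV[rat]_d) : submod (I_le n k lam) := \sum_i c 0 i *: y (p i).
pose g c : Rmod n k lam := \pi_(Rmod n k lam) (G c).
have G_lin : linear G.
  move=> a u v; rewrite scaler_sumr -big_split; apply: eq_bigr => i _.
  by rewrite !mxE scalerDl scalerA.
have val_G c : val (G c) = \sum_i c 0 i *: mono_class k (wt k A) (p i).
  by rewrite raddf_sum.
have act_G s c : val (submod_map (Ile s) (G c)) =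
    \sum_i c 0 i *: mono_class k (wt k A) (p i * s)%g.
  by rewrite /= val_G linear_sum; apply: eq_bigr => i _; rewrite linearZ -mono_class_act.
have pi_eq (u v : submod (I_le n k lam)) :
    (\pi_(Rmod n k lam) u == \pi_(Rmod n k lam) v) = (val u - val v \in I_lt n k lam).
  by rewrite eq_lquot.
have g_lin : linear g by move=> a u v; rewrite /g G_lin linearP.
have sum_D (V : nmodType) (F : 'S_n -> V) : \sum_(q | Des q == A) F q = \sum_i F (p i).
  by rewrite -(big_enum_val (A := mem D)) /=; apply: eq_bigl => q; rewrite inE.
have g_inj : injective g.
  move=> c c' /eqP; rewrite pi_eq !val_G -sumrB => diff_lt; apply/rowP => i.
  pose b q := \sum_j (c 0 j - c' 0 j) * (p j == q)%:R.
  have bE j : b (p j) = c 0 j - c' 0 j.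
    rewrite /b (bigD1 j) //= eqxx mulr1 big1 ?addr0 // => l neq_lj.
    by rewrite (inj_eq enum_val_inj) (negbTE neq_lj) mulr0.
  apply/eqP; rewrite -subr_eq0 -bE; apply/eqP.
  apply: (descent_classes_free hk hlam) (DesD i); rewrite sum_D.
  by under eq_bigr => j _ do rewrite bE scalerBl.
have g_surj v : exists c, g c = v.
  suff [c eq_c] : exists c, val (repr v) - val (G c) \in I_lt n k lam.
    by exists c; apply/esym/eqP; rewrite -[v]reprK pi_eq.
  have /lspanP[m [a [w [w_le ->]]]] := valP (repr v).
  have /choice[c cP] : forall j, exists c, w j - val (G c) \in I_lt n k lam.
    move=> j; have [s le_s def_w] := w_le j.
    have [/eqP DsA|neq_s] := boolP (Des s == A).
      have sD : s \in D by rewrite inE DsA.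
      exists (delta_mx 0 (enum_rank_in sD s)); rewrite val_G.
      rewrite (bigD1 (enum_rank_in sD s)) //= big1 ?addr0 => [|i neq_i].
        by rewrite mxE !eqxx scale1r /p enum_rankK_in // def_w (a_monE hk) DsA subrr rpred0.
      by rewrite mxE (negbTE neq_i) scale0r.
    exists 0; rewrite val_G big1 ?subr0 => [|i _]; last by rewrite mxE scale0r.
    apply: lspan_gen; exists s => //; split=> //.
    by move/(exp_bipart_lam hk hlam)/eqP; apply/negP.
  exists (\sum_j a j *: c j).
  have -> : val (G (\sum_j a j *: c j)) = \sum_j a j *: val (G (c j)).
    rewrite val_G; under [RHS]eq_bigr => j _ do rewrite val_G scaler_sumr.
    rewrite exchange_big /=; apply: eq_bigr => i _.
    rewrite summxE scaler_suml; apply: eq_bigr => j _.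
    by rewrite mxE scalerA.
  by rewrite -sumrB; apply: rpred_sum => j _; rewrite -scalerBr rpredZ.
pose rho s : 'M[rat]_d := \matrix_(i, j) descent_coef Vi s (p i) (p j).
have g_rho s c : Rmod_act Ile s (g c) = g (c *m rho s).
  rewrite /g (Rmod_actE Ile Ilt); apply/eqP; rewrite pi_eq act_G val_G.
  have -> : \sum_i (c *m rho s) 0 i *: mono_class k (wt k A) (p i) =
      \sum_i c 0 i *: \sum_j rho s i j *: mono_class k (wt k A) (p j).
    under eq_bigr => i _ do rewrite mxE scaler_suml.
    rewrite exchange_big; apply: eq_bigr => i _; rewrite scaler_sumr.
    by apply: eq_bigr => j _; rewrite scalerA.
  rewrite -sumrB; apply: rpred_sum => i _; rewrite -scalerBr rpredZ //.
  rewrite (eq_bigr (fun j => descent_coef Vi s (p i) (p j) *: mono_class k (wt k A) (p j))).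
    by have := act_descent_class hk hlam s ViV VVi (DesD i); rewrite sum_D.
  by move=> j _; rewrite mxE.
have eq_mulmx (X Y : 'M[rat]_d) : (forall c : 'rV_d, c *m X = c *m Y) -> X = Y.
  by move=> eqXY; apply/row_matrixP => i; rewrite !rowE.
have rho_repr : mx_repr [set: 'S_n] rho.
  split=> [|s t _ _]; apply: eq_mulmx => c; apply: g_inj; rewrite -g_rho.
    rewrite mulmx1 /g (Rmod_actE Ile Ilt); apply/eqP; rewrite pi_eq act_G val_G.
    under eq_bigr => i _ do rewrite mulg1.
    by rewrite subrr rpred0.
  rewrite mulmxA -!g_rho /g !(Rmod_actE Ile Ilt); apply/eqP; rewrite pi_eq act_G.
  have -> : val (submod_map (Ile t) (submod_map (Ile s) (G c))) =
      \sum_i c 0 i *: mono_class k (wt k A) (p i * (s * t))%g.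
    transitivity (Hquot_act t (\sum_i c 0 i *: mono_class k (wt k A) (p i * s)%g)).
      by rewrite -act_G.
    rewrite linear_sum; apply: eq_bigr => i _.
    by rewrite mulgA linearZ; congr (_ *: _); apply: mono_class_act.
  by rewrite subrr rpred0.
exists d, (MxRepresentation rho_repr); split.
  apply/cfunP => s; rewrite (solomon_charE ViV VVi) cfunE inE mulr1n.
  rewrite map_reprE trace_map_mx; congr (ratr _); rewrite sum_D.
  by apply: eq_bigr => i _; rewrite mxE.
have /choice[f gf] := g_surj.
have fg : cancel g f by move=> c; apply: g_inj.
have f_lin : linear f.
  by move=> a u v; apply: g_inj; rewrite g_lin !gf.
pose fL : {linear Rmod n k lam -> 'rV[rat]_d} :=
  HB.pack f (GRing.isLinear.Build rat (Rmod n k lam) 'rV[rat]_d *:%R f f_lin).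
exists fL; split; first by exists g.
by move=> s v; apply: g_inj; rewrite /= -g_rho !gf.
Qed.
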